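(* Let $\pi$ be a probability density on $\mathbb{R}^d$ with $\pi(x)>0$ for all $x$ and $\log\pi\in C^1(\mathbb{R}^d)$, and assume: (i) $\pi(x)=\pi_1(x_1)\pi_{2:d}(x_2,\dots,x_d)$ for some densities $\pi_1$ on $\mathbb{R}$ and $\pi_{2:d}$ on $\mathbb{R}^{d-1}$; (ii) for some $q\in[0,1)$, $\left|\frac{d}{dx_1}\log\pi_1(x_1)\right|=\Theta(|x_1|^q)$ as $|x_1|\to\infty$. For $\lambda>0$ let $\pi^{(\lambda)}(x):=\lambda^{-1}\pi(x_1/\lambda,x_2,\dots,x_d)$, fix $\sigma>0$, and let $P^M_\lambda$ be the Metropolis--Hastings kernel with target $\pi^{(\lambda)}$ and MALA candidate kernel $Q^M_\lambda(x,\cdot)=N\big(x+\frac{\sigma^2}{2}\nabla\log\pi^{(\lambda)}(x),\sigma^2\mathbb{I}_d\big)$. Then there is $\gamma>0$ such that $\mathrm{Gap}(P^M_\lambda)\le\Theta\big(e^{-\gamma\lambda^{-(1+q)}+q\log\lambda}\big)$ as $\lambda\downarrow0$, i.e. $\limsup_{\lambda\downarrow0}\mathrm{Gap}(P^M_\lambda)\,e^{\gamma\lambda^{-(1+q)}-q\log\lambda}<\infty$.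
   Context: Metropolis--Hastings kernel with target density $\pi$ and candidate kernel $Q(x,dy)=q(x,y)dy$: $P(x,dy)=\alpha(x,y)Q(x,dy)+r(x)\delta_x(dy)$ with $\alpha(x,y)=\min\{1,\pi(y)q(y,x)/(\pi(x)q(x,y))\}$ and $r(x)=1-\int\alpha(x,y)Q(x,dy)$. $\mathrm{Gap}(P)=\inf_{f\in L^2_{0,1}(\pi)}\frac12\int (f(y)-f(x))^2\pi(dx)P(x,dy)$ with $L^2_{0,1}(\pi)=\{f:\mathbb{E}_\pi f=0,\mathrm{Var}_\pi f=1\}$. $F=\Theta(G)$ as $|x_1|\to\infty$ means $\liminf F/G>0$ and $\limsup F/G<\infty$. *)

(* Defs.v *)
From HB Require Import structures.
From mathcomp Require Import all_boot all_order all_algebra.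
From mathcomp Require Import all_classical all_reals all_analysis.
Set Implicit Arguments. Unset Strict Implicit. Unset Printing Implicit Defensive.
Import Order.TTheory GRing.Theory Num.Theory.
Import numFieldNormedType.Exports.
Local Open Scope classical_set_scope.
Local Open Scope ring_scope.

(* Lebesgue integral on R^n of a function with values in \bar R, written
   as the iterated one-dimensional Lebesgue integral (by Tonelli this is
   the integral w.r.t. n-dimensional Lebesgue measure for nonnegative
   Borel functions, which is the only way it is used below). *)
Fixpoint iint (R : realType) (n : nat) : ('rV[R]_n -> \bar R) -> \bar R :=
  match n with
  | 0 => fun f => f 0
  | n'.+1 => fun f =>
      (\int[@lebesgue_measure R]_t
         iint (fun y : 'rV[R]_n' => f (row_mx (const_mx t : 'rV[R]_1) y)))%E
  end.

Definition borel_set (R : realType) (n : nat) (A : set 'rV[R]_n) : Prop :=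
  <<s [set U : set 'rV[R]_n | open U] >> A.

Definition borel_fun (R : realType) (n : nat) (f : 'rV[R]_n -> R) : Prop :=
  forall B : set R, measurable B -> borel_set (f @^-1` B).

Definition densityn (R : realType) (n : nat) (p : 'rV[R]_n -> R) : Prop :=
  borel_fun p /\ (forall x, 0 <= p x) /\ iint (fun x => (p x)%:E) = 1%E.

Definition density1 (R : realType) (p : R -> R) : Prop :=
  measurable_fun setT p /\ (forall t, 0 <= p t) /\
  (\int[@lebesgue_measure R]_t (p t)%:E = 1)%E.

Definition evec (R : realType) (n : nat) (i : 'I_n) : 'rV[R]_n := delta_mx 0 i.

Definition C1 (R : realType) (n : nat) (g : 'rV[R]_n -> R) : Prop :=
  forall i : 'I_n, (forall x, derivable g x (evec R i)) /\
                   continuous (fun x => derive g x (evec R i)).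

Definition grad (R : realType) (n : nat) (g : 'rV[R]_n -> R) (x : 'rV[R]_n)
  : 'rV[R]_n := \row_i derive g x (evec R i).

Definition sqnorm (R : realType) (n : nat) (v : 'rV[R]_n) : R :=
  \sum_(i < n) v 0 i ^+ 2.

Definition tailv (R : realType) (n : nat) (x : 'rV[R]_n.+1) : 'rV[R]_n :=
  \row_(j < n) x 0 (lift ord0 j).

Definition scale_target (R : realType) (n : nat) (lam : R)
  (p : 'rV[R]_n.+1 -> R) (x : 'rV[R]_n.+1) : R :=
  lam^-1 * p (\row_j (if j == ord0 then x 0 j / lam else x 0 j)).

Definition mala_density (R : realType) (n : nat) (p : 'rV[R]_n -> R) (sigma : R)
  (x y : 'rV[R]_n) : R :=
  (Num.sqrt (2 * pi * sigma ^+ 2)) ^- n *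
  expR (- sqnorm (y - (x + (sigma ^+ 2 / 2) *: grad (fun z => ln (p z)) x))
        / (2 * sigma ^+ 2)).

Definition mh_accept (R : realType) (n : nat) (p : 'rV[R]_n -> R)
  (qd : 'rV[R]_n -> 'rV[R]_n -> R) (x y : 'rV[R]_n) : R :=
  Num.min 1 (p y * qd y x / (p x * qd x y)).

Definition mh_reject (R : realType) (n : nat) (p : 'rV[R]_n -> R)
  (qd : 'rV[R]_n -> 'rV[R]_n -> R) (x : 'rV[R]_n) : R :=
  1 - fine (iint (fun y => (mh_accept p qd x y * qd x y)%:E)).

(* integral of a nonnegative g against the MH kernel
   P(x,dy) = alpha(x,y) Q(x,dy) + r(x) delta_x(dy) *)
Definition mh_int (R : realType) (n : nat) (p : 'rV[R]_n -> R)
  (qd : 'rV[R]_n -> 'rV[R]_n -> R) (x : 'rV[R]_n) (g : 'rV[R]_n -> R) : \bar R :=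
  (iint (fun y => (g y * (mh_accept p qd x y * qd x y))%:E)
   + (mh_reject p qd x * g x)%:E)%E.

Definition expect (R : realType) (n : nat) (p : 'rV[R]_n -> R) (g : 'rV[R]_n -> R)
  : \bar R :=
  (iint (fun x => (Num.max (g x) 0 * p x)%:E)
   - iint (fun x => (Num.max (- g x) 0 * p x)%:E))%E.

Definition variance (R : realType) (n : nat) (p : 'rV[R]_n -> R) (g : 'rV[R]_n -> R)
  : \bar R :=
  expect p (fun x => (g x - fine (expect p g)) ^+ 2).

Definition L2_01 (R : realType) (n : nat) (p : 'rV[R]_n -> R) (f : 'rV[R]_n -> R)
  : Prop :=
  borel_fun f /\ expect p f = 0%E /\ variance p f = 1%E.

Definition dirichlet (R : realType) (n : nat) (p : 'rV[R]_n -> R)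
  (qd : 'rV[R]_n -> 'rV[R]_n -> R) (f : 'rV[R]_n -> R) : \bar R :=
  ((2^-1)%:E * iint (fun x => (p x)%:E * mh_int p qd x (fun y => ((f y - f x) ^+ 2)%R)))%E.

Definition Gap (R : realType) (n : nat) (p : 'rV[R]_n -> R)
  (qd : 'rV[R]_n -> 'rV[R]_n -> R) : \bar R :=
  ereal_inf [set dirichlet p qd f | f in L2_01 p].

(* Main.v *)
Require Import Defs.
From HB Require Import structures.
From mathcomp Require Import all_boot all_order all_algebra.
From mathcomp Require Import all_classical all_reals all_analysis.
From mathcomp Require Import measurable_realfun ring lra.
Import Order.TTheory GRing.Theory Num.Theory.
Import numFieldNormedType.Exports.
Local Open Scope classical_set_scope.
Local Open Scope ring_scope.
Set Implicit Arguments. Unset Strict Implicit. Unset Printing Implicit Defensive.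

(** Test the gap on the normalized indicator of [A = {|x_1| >= lam M}], where
    [M >= 1] is such that [|(ln pi_1)'| >= c] outside [-M, M]. The mass [a] of [A]
    does not depend on [lam], and by reversibility
    [Gap <= (a (1 - a))^-1 * (mass proposed from A into its complement)].
    From [x_1 = lam u] the drift has size at least [sigma^2 c / (2 lam)]. As long as
    [|u| < sigma^2 c / (8 lam^2)] it overshoots the complement of [A], so that a
    proposal into it is a Gaussian deviation of order [1 / lam]; the remaining [u]
    lie in the exponential tail of [pi_1]. Both contributions are
    [O(exp (- k / lam^2))], which is smaller than needed because [1 + q < 2]. *)

(** * Borel vectors and iterated integrals *)

(** The acceptance probability is never estimated. Multiplied by [p x * qd x y] it becomes the
    minimum of the two opposite proposal flows, hence at most the one that leaves [A], whichever of
    the two points lies in [A]. What makes [A] a bottleneck is that the drift grows like [1 / lam]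
    while the noise level [sigma] stays fixed and the central region shrinks to width of order
    [lam]: a proposal made outside is thrown across the centre to the other side instead of landing
    in it.

    Two features of the definitions shape the work. [iint] iterates one-dimensional integrals
    whereas [borel_fun] speaks of open sets of the whole space, so measurability of partial
    integrals and Tonelli's theorem are obtained by induction on the dimension, and later integrals
    are reduced to the first coordinate by splitting off the others. Moreover the factor [p1] is
    only given as a measurable density, so its positivity, continuity and differentiability have to
    be drawn from those of [p]. *)

Definition borelV (R : realType) (n : nat) :=
  g_sigma_algebraType (@open 'rV[R]_n).

Section borel_vectors.
Context {R : realType}.

Lemma borel_fun_measurable n (f : 'rV[R]_n -> R) :
  borel_fun f <-> measurable_fun (T := borelV R n) setT f.
Proof.
split => [bf _ B mB|mf B mB].
  by rewrite setTI; exact: bf.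
by have := mf measurableT B mB; rewrite setTI.
Qed.

Lemma continuous_borelV n (f : 'rV[R]_n -> R) :
  continuous f -> measurable_fun (T := borelV R n) setT f.
Proof.
move=> /continuousP cf; apply: (measurability _ (RGenOpens.measurableE R)).
move=> _ [_ [a [b ->] <-]]; rewrite setTI; apply: sub_sigma_algebra.
exact/cf/interval_open.
Qed.

Lemma measurable_coord n (i : 'I_n) :
  measurable_fun (T := borelV R n) setT (fun x : 'rV[R]_n => x 0 i).
Proof. by apply: continuous_borelV; exact: coord_continuous. Qed.

(* Open sets are countable unions of balls with rational centre and radius
   [1 / k.+1], and preimages of balls only involve the coordinates. *)
Lemma measurable_fun_rV d (T : measurableType d) n (g : T -> 'rV[R]_n) :
  (forall i, measurable_fun setT (fun t => g t 0 i)) ->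
  measurable_fun (U := borelV R n) setT g.
Proof.
move=> mg; apply: (@measurability _ _ T (borelV R n) setT g (@open 'rV[R]_n) erefl).
move=> _ [U oU <-].
rewrite setTI.
pose B (ck : 'rV[rat]_n * nat) : set 'rV[R]_n :=
  [set x | forall i, `|ratr (ck.1 0 i) - x 0 i| < ck.2.+1%:R^-1].
have mB ck : measurable (g @^-1` B ck).
  have -> : g @^-1` B ck = \bigcap_(i in [set: 'I_n])
     ((fun t => `|ratr (ck.1 0 i) - g t 0 i|) @^-1` `]-oo, (ck.2.+1%:R^-1)[).
    apply/seteqP; split => [t Bt i _ /=|t Bt i].
      by rewrite in_itv/=; exact: Bt.
    by have := Bt i Logic.I; rewrite /= in_itv.
  apply: fin_bigcap_measurable => // i _; rewrite -[X in measurable X]setTI.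
  suff : measurable_fun setT (fun t => `|ratr (ck.1 0 i) - g t 0 i|) by exact.
  by apply: measurableT_comp => //; apply: measurable_funB.
have -> : U = \bigcup_(ck in [set: 'rV[rat]_n * nat])
    [set x | B ck `<=` U /\ B ck x].
  apply/seteqP; split => [x Ux|x [ck _ [/= BU]]]; last exact: BU.
  have := oU; rewrite openE => /(_ _ Ux) /nbhs_ballP[e /= e0 eU].
  have e20 : 0 < e / 2 by rewrite divr_gt0.
  have [k _ ke] := @near_infty_natSinv_lt R (PosNum e20).
  have {ke} /= ke := ke k (leqnn k).
  have kx i : exists r : rat, `|ratr r - x 0 i| < k.+1%:R^-1.
    have [|r] := @rat_in_itvoo R (x 0 i) (x 0 i + k.+1%:R^-1).
      by rewrite ltrDl invr_gt0.
    rewrite in_itv/= => /andP[r1 r2]; exists r.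
    by rewrite gtr0_norm ?subr_gt0// ltrBlDl.
  pose c := \row_i projT1 (cid (kx i)).
  have cx i : `|ratr (c 0 i) - x 0 i| < k.+1%:R^-1.
    by rewrite mxE; case: cid.
  exists (c, k) => //; split => // y By; apply: eU; split => // i j.
  rewrite ord1 /ball/= -[x 0 j](subrK (ratr (c 0 j))) -addrA.
  rewrite (le_lt_trans (ler_normD _ _))// (splitr e) distrC ltrD//.
    exact: lt_trans (cx j) ke.
  exact: lt_trans (By j) ke.
rewrite preimage_bigcup; apply: countable_bigcupT_measurable => // ck.
have [BU|BU] := pselect (B ck `<=` U).
  by rewrite (_ : _ @^-1` _ = g @^-1` B ck)//; apply/seteqP; split => t //= [].
by rewrite (_ : _ @^-1` _ = set0)//; apply/seteqP; split => t //= [].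
Qed.

(** Bridges two indexings: [row_mx], as used by [iint], splits indices by [lshift] and [rshift],
    while [tailv] and the product hypothesis use [ord0] and [lift ord0]. *)
Lemma row_mx_consE n (t : R) (y : 'rV[R]_n) i :
  (row_mx (const_mx t : 'rV[R]_1) y) 0 i =
  if unlift ord0 i is Some j then y 0 j else t.
Proof.
case: unliftP => [j|] ->.
  by rewrite (_ : lift ord0 j = rshift 1 j) ?row_mxEr//; exact: val_inj.
rewrite (_ : ord0 = lshift n (ord0 : 'I_1)); last exact: val_inj.
by rewrite row_mxEl mxE.
Qed.

Lemma row_mx_cons0 n (t : R) (y : 'rV[R]_n) :
  (row_mx (const_mx t : 'rV[R]_1) y : 'rV_n.+1) 0 ord0 = t.
Proof. by rewrite row_mx_consE unlift_none. Qed.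

Lemma row_mx_consS n (t : R) (y : 'rV[R]_n) j :
  (row_mx (const_mx t : 'rV[R]_1) y : 'rV_n.+1) 0 (lift ord0 j) = y 0 j.
Proof. by rewrite row_mx_consE liftK. Qed.

Lemma tailv_cons n (t : R) (y : 'rV[R]_n) :
  tailv (row_mx (const_mx t : 'rV[R]_1) y) = y.
Proof. by apply/rowP => j; rewrite mxE row_mx_consS. Qed.

Lemma measurable_cons d (T : measurableType d) n (f : T -> R)
    (g : T -> 'rV[R]_n) : measurable_fun setT f ->
  measurable_fun (U := borelV R n) setT g ->
  measurable_fun (U := borelV R n.+1) setT
    (fun t => row_mx (const_mx (f t) : 'rV[R]_1) (g t)).
Proof.
move=> mf mg; apply: measurable_fun_rV => i.
case: (unliftP ord0 i) => [j|] ->.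
  under eq_fun do rewrite row_mx_consS.
  exact: (measurableT_comp (measurable_coord j) mg).
by under eq_fun do rewrite row_mx_cons0.
Qed.

End borel_vectors.

(** * Tonelli's theorem for iterated integrals *)

Section iterated_integral.
Context {R : realType}.
Local Open Scope ereal_scope.
Notation mu := (@lebesgue_measure R).

Lemma eq_iint n (f g : 'rV[R]_n -> \bar R) : f =1 g -> iint f = iint g.
Proof. by move=> /funext ->. Qed.

Lemma iint_ge0 n (f : 'rV[R]_n -> \bar R) : (forall x, 0 <= f x) -> 0 <= iint f.
Proof.
elim: n f => [|n ih] f f0 /=; first exact: f0.
by apply: integral_ge0 => t _; apply: ih => y.
Qed.

(** The parameter space [T] is arbitrary so that the induction closes: the first coordinate of the
    vector is moved into the parameter, which then ranges over [T * R], and the one-dimensional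
    Tonelli theorem integrates it out. *)
Lemma measurable_iint d (T : measurableType d) n
    (F : T * borelV R n -> \bar R) : measurable_fun setT F ->
  (forall z, 0 <= F z) ->
  measurable_fun setT (fun t => iint (fun y : 'rV[R]_n => F (t, y))).
Proof.
elim: n d T F => [|n ih] d T F mF F0 /=.
  exact: (measurable_fun_pair1 (0%R : borelV R 0) mF).
pose G (z : (T * R) * borelV R n) :=
  F (z.1.1, row_mx (const_mx z.1.2 : 'rV[R]_1) z.2).
have mG : measurable_fun setT G.
  apply: (measurableT_comp mF); apply: measurable_fun_pair.
    exact: (measurableT_comp measurable_fst measurable_fst).
  apply: measurable_cons => //.
  exact: (measurableT_comp measurable_snd measurable_fst).
have := ih _ _ G mG (fun=> F0 _).
move=> /(measurable_fun_fubini_tonelli_F (m2 := mu)); apply => z.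
by apply: iint_ge0 => y; exact: F0.
Qed.

Section measurable_sections.
Variables (n : nat) (f : borelV R n.+1 -> \bar R).
Hypothesis mf : measurable_fun setT f.
Hypothesis f0 : forall x, 0 <= f x.

Lemma measurable_iint_cons_pair : measurable_fun setT (fun z : R * borelV R n =>
  f (row_mx (const_mx z.1 : 'rV[R]_1) z.2)).
Proof. by apply: (measurableT_comp mf); exact: measurable_cons. Qed.

Lemma measurable_iint_cons : measurable_fun setT (fun t : R =>
  iint (fun y : 'rV[R]_n => f (row_mx (const_mx t : 'rV[R]_1) y))).
Proof. by have := measurable_iint measurable_iint_cons_pair (fun=> f0 _). Qed.

Lemma measurable_section_cons t : measurable_fun setT (fun y : borelV R n =>
  f (row_mx (const_mx t : 'rV[R]_1) y)).
Proof. by have := measurable_fun_pair2 t measurable_iint_cons_pair. Qed.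

End measurable_sections.

Lemma le_iint n (f g : borelV R n -> \bar R) :
  measurable_fun setT f -> measurable_fun setT g ->
  (forall x, 0 <= f x) -> (forall x, f x <= g x) -> iint f <= iint g.
Proof.
elim: n f g => [|n ih] f g mf mg f0 fg /=; first exact: fg.
have g0 x : 0 <= g x by exact: le_trans (f0 x) (fg x).
apply: ge0_le_integral => //.
- by move=> t _; apply: iint_ge0 => y.
- exact: measurable_iint_cons.
- exact: measurable_iint_cons.
- by move=> t _; apply: ih => //; exact: measurable_section_cons.
Qed.

Lemma iintD n (f g : borelV R n -> \bar R) :
  measurable_fun setT f -> measurable_fun setT g ->
  (forall x, 0 <= f x) -> (forall x, 0 <= g x) ->
  iint (fun x => f x + g x) = iint f + iint g.
Proof.
elim: n f g => [|n ih] f g mf mg f0 g0 //=.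
rewrite -ge0_integralD//.
- by apply: eq_integral => t _; rewrite ih//; exact: measurable_section_cons.
- by move=> t _; apply: iint_ge0 => y.
- exact: measurable_iint_cons.
- by move=> t _; apply: iint_ge0 => y.
- exact: measurable_iint_cons.
Qed.

Lemma iintZl n (k : \bar R) (f : borelV R n -> \bar R) :
  measurable_fun setT f -> (forall x, 0 <= f x) -> 0 <= k ->
  iint (fun x => k * f x) = k * iint f.
Proof.
elim: n f => [|n ih] f mf f0 k0 //=.
rewrite -ge0_integralZl//.
- by apply: eq_integral => t _; rewrite ih//; exact: measurable_section_cons.
- exact: measurable_iint_cons.
- by move=> t _; apply: iint_ge0 => y.
Qed.

Lemma integral_iint_swap n (F : R * borelV R n -> \bar R) :
  measurable_fun setT F -> (forall z, 0 <= F z) ->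
  \int[mu]_t iint (fun y : 'rV[R]_n => F (t, y)) =
  iint (fun y : 'rV[R]_n => \int[mu]_t F (t, y)).
Proof.
elim: n F => [//|n ih] F mF F0 /=.
pose G (z : (R * R) * borelV R n) :=
  F (z.1.1, row_mx (const_mx z.1.2 : 'rV[R]_1) z.2).
have mG : measurable_fun setT G.
  apply: (measurableT_comp mF); apply: measurable_fun_pair.
    exact: (measurableT_comp measurable_fst measurable_fst).
  apply: measurable_cons => //.
  exact: (measurableT_comp measurable_snd measurable_fst).
(* The plane version exchanges [t] with the first coordinate [s] of the vector; for fixed [s] the
   induction hypothesis moves [t] past the remaining ones. *)
have /= -> := fubini_tonelli (m1 := mu) (m2 := mu)
  _ (measurable_iint mG (fun=> F0 _)) (fun=> iint_ge0 (fun=> F0 _)).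
apply: eq_integral => s _.
pose Gs (z : R * borelV R n) := G ((z.1, s), z.2).
apply: (ih Gs) => [|z]; last exact: F0.
apply: (measurableT_comp mG); apply: measurable_fun_pair => //.
exact: measurable_fun_pair.
Qed.

(** Coordinates of the first vector are carried past the second one by one. This exchange is what
    identifies the flow out of a set with the flow into it. *)
Lemma iint_swap m n (F : borelV R m * borelV R n -> \bar R) :
  measurable_fun setT F -> (forall z, 0 <= F z) ->
  iint (fun x : 'rV[R]_m => iint (fun y : 'rV[R]_n => F (x, y))) =
  iint (fun y : 'rV[R]_n => iint (fun x : 'rV[R]_m => F (x, y))).
Proof.
elim: m F => [//|m ih] F mF F0 /=.
transitivity (\int[mu]_t iint (fun y : 'rV[R]_n => iint (fun x : 'rV[R]_m =>
    F (row_mx (const_mx t : 'rV[R]_1) x, y)))).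
  apply: eq_integral => t _.
  pose Ft (z : borelV R m * borelV R n) :=
    F (row_mx (const_mx t : 'rV[R]_1) z.1, z.2).
  apply: (ih Ft) => [|z]; last exact: F0.
  apply: (measurableT_comp mF); apply: measurable_fun_pair => //.
  by apply: measurable_cons => //; exact: measurable_cst.
pose G (z : (R * borelV R n) * borelV R m) :=
  F (row_mx (const_mx z.1.1 : 'rV[R]_1) z.2, z.1.2).
have mG : measurable_fun setT G.
  apply: (measurableT_comp mF); apply: measurable_fun_pair.
    apply: measurable_cons => //.
    exact: (measurableT_comp measurable_fst measurable_fst).
  exact: (measurableT_comp measurable_snd measurable_fst).
by have := integral_iint_swap (measurable_iint mG (fun=> F0 _))
  (fun=> iint_ge0 (fun=> F0 _)).
Qed.

(** Both the scaled target and the Gaussian proposal split off their first coordinate; this turns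
    questions about that coordinate into integrals over the line. *)
Lemma iint_prod n (h : R -> \bar R) (k : borelV R n -> \bar R) :
  measurable_fun setT h -> measurable_fun setT k ->
  (forall t, 0 <= h t) -> (forall y, 0 <= k y) ->
  iint (fun x : 'rV[R]_n.+1 => h (x 0%R ord0) * k (tailv x)) =
  (\int[mu]_t h t) * iint k.
Proof.
move=> mh mk h0 k0 /=.
transitivity (\int[mu]_t (iint k * h t)); last first.
  by rewrite ge0_integralZl// ?iint_ge0// muleC.
apply: eq_integral => t _; rewrite muleC -iintZl//.
by apply: eq_iint => y; rewrite row_mx_cons0 tailv_cons.
Qed.

End iterated_integral.

(** * Conductance bound for Metropolis-Hastings kernels *)

Section conductance.
Context {R : realType} (n : nat).
Variables (p : 'rV[R]_n -> R) (qd : 'rV[R]_n -> 'rV[R]_n -> R).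
Variables (A : set 'rV[R]_n) (a : R).
Hypothesis mp : measurable_fun (T := borelV R n) setT p.
Hypothesis p_gt0 : forall x, 0 < p x.
Hypothesis mqd :
  measurable_fun setT (fun z : borelV R n * borelV R n => qd z.1 z.2).
Hypothesis qd_gt0 : forall x y, 0 < qd x y.
Hypothesis mA : measurable (A : set (borelV R n)).
Hypothesis p1 : iint (EFin \o p) = 1%E.
Hypothesis pA : iint (fun x => (\1_A x * p x)%:E) = a%:E.
Hypotheses (a_gt0 : 0 < a) (a_lt1 : a < 1).

(** Detailed balance: the right-hand side is symmetric in [x] and [y]. It also avoids the quotient
    in [mh_accept] from here on. *)
Lemma mh_acceptM x y : p x * (mh_accept p qd x y * qd x y) =
  Num.min (p x * qd x y) (p y * qd y x).
Proof.
have pq : 0 < p x * qd x y by rewrite mulr_gt0.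
rewrite mulrCA /mh_accept minr_pMl ?ltW// mul1r divfK//.
by rewrite gt_eqF.
Qed.

Let mA1 : measurable_fun setT (fun x : borelV R n => \1_A x : R).
Proof. exact: measurable_indic. Qed.

Let mAC1 : measurable_fun setT (fun x : borelV R n => \1_(~` A) x : R).
Proof. by apply: measurable_indic; exact: measurableC. Qed.

Lemma iint_indicC : iint (fun x => (\1_(~` A) x * p x)%:E) = (1 - a)%:E.
Proof.
have m1 : measurable_fun (T := borelV R n) setT (fun x => (\1_A x * p x)%:E).
  by apply/measurable_EFinP; exact: measurable_funM.
have m2 : measurable_fun (T := borelV R n) setT
    (fun x => (\1_(~` A) x * p x)%:E).
  by apply/measurable_EFinP; exact: measurable_funM.
have := p1.
rewrite (_ : EFin \o p = fun x => ((\1_A x * p x)%:E + (\1_(~` A) x * p x)%:E)%E).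
  rewrite (iintD m1 m2) ?pA => [h|x|x]; last 2 first.
  - by rewrite lee_fin mulr_ge0// ltW.
  - by rewrite lee_fin mulr_ge0// ltW.
  by rewrite EFinB -h addeAC subee// add0e.
apply/funext => x /=; rewrite -EFinD -mulrDl.
rewrite !indicE in_setC; case: (x \in A) => /=; last by rewrite add0r mul1r.
by rewrite addr0 mul1r.
Qed.

(** The standard deviation of [\1_A] under [p], since [A] has mass [a]. *)
Let s := Num.sqrt (a * (1 - a)).

Let ss : s ^+ 2 = a * (1 - a).
Proof. by rewrite sqr_sqrtr// mulr_ge0 ?subr_ge0 ?ltW. Qed.

Let s_gt0 : 0 < s.
Proof. by rewrite sqrtr_gt0 mulr_gt0// subr_gt0. Qed.

Definition normalized_indic (x : 'rV[R]_n) : R := (\1_A x - a) / s.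

Let f := normalized_indic.

Let iintZ_indic (B : set 'rV[R]_n) (k : R) : measurable (B : set (borelV R n)) ->
  0 <= k -> iint (fun x => (k * \1_B x * p x)%:E) =
  (k%:E * iint (fun x => (\1_B x * p x)%:E))%E.
Proof.
move=> mB k0; rewrite -iintZl//.
- by apply: eq_iint => x; rewrite -EFinM mulrA.
- apply/measurable_EFinP; apply: measurable_funM; last exact: mp.
  exact: measurable_indic.
- by move=> x; rewrite lee_fin mulr_ge0// ltW.
Qed.

Lemma L2_01_normalized_indic : L2_01 p f.
Proof.
have mAC : measurable (~` A : set (borelV R n)) by exact: measurableC.
have a1 : 0 < 1 - a by rewrite subr_gt0.
(* [expect] subtracts the integral of the negative part from that of the positive part. Here these
   parts live on [A] and on its complement, with equal integrals [a * (1 - a) / s]. *)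
have maxf x : Num.max (f x) 0 = (1 - a) / s * \1_A x.
  rewrite /f /normalized_indic indicE; case: (x \in A) => /=.
    by rewrite mulr1 max_l// divr_ge0 ?ltW.
  by rewrite mulr0 max_r// sub0r mulNr oppr_le0 divr_ge0 ?ltW.
have minf x : Num.max (- f x) 0 = a / s * \1_(~` A) x.
  rewrite /f /normalized_indic !indicE in_setC; case: (x \in A) => /=.
    by rewrite mulr0 max_r// oppr_le0 divr_ge0 ?ltW.
  by rewrite mulr1 max_l// sub0r mulNr opprK// divr_ge0 ?ltW.
have Ef : expect p f = 0%E.
  rewrite /expect; under eq_iint do rewrite maxf.
  under [X in (_ - X)%E]eq_iint do rewrite minf.
  rewrite !iintZ_indic ?divr_ge0 ?ltW// pA iint_indicC -!EFinM -EFinB.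
  by congr EFin; ring.
suff Vf : Defs.variance p f = 1%E.
  split => //; apply/borel_fun_measurable; apply: measurable_funM => //.
  exact: measurable_funB.
rewrite /Defs.variance Ef /expect /=.
under [X in (_ - X)%E]eq_iint.
  by move=> x; rewrite max_r ?oppr_le0 ?sqr_ge0// mul0r; over.
have fE x : Num.max ((f x - 0) ^+ 2) 0 * p x =
    ((1 - a) / s) ^+ 2 * \1_A x * p x + (a / s) ^+ 2 * \1_(~` A) x * p x.
  rewrite max_l ?sqr_ge0// subr0 -mulrDl; congr (_ * _).
  rewrite /f /normalized_indic !indicE in_setC; case: (x \in A) => /=.
    by rewrite mulr0 mulr1 addr0.
  by rewrite mulr0 mulr1 !add0r mulNr sqrrN.
under eq_iint do rewrite fE EFinD.
rewrite iintD//=.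
- rewrite !iintZ_indic ?sqr_ge0// pA iint_indicC -!EFinM -EFinD.
  have -> : iint (fun _ : 'rV[R]_n => 0%E) = 0%E :> \bar R.
    have := @iintZl R n 0%E (EFin \o p); under eq_iint do rewrite mul0e.
    rewrite mul0e; apply => //; last by move=> x; rewrite lee_fin ltW.
    exact/measurable_EFinP.
  rewrite sube0; congr EFin; rewrite !expr_div_n ss; field.
  by rewrite !gt_eqF.
- apply/measurable_EFinP; apply: measurable_funM => //; exact: measurable_funM.
- apply/measurable_EFinP; apply: measurable_funM => //; exact: measurable_funM.
- by move=> x; rewrite lee_fin 2?mulr_ge0 ?sqr_ge0// ltW.
- by move=> x; rewrite lee_fin 2?mulr_ge0 ?sqr_ge0// ltW.
Qed.

Let flow (z : borelV R n * borelV R n) : R :=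
  \1_A z.1 * p z.1 * (\1_(~` A) z.2 * qd z.1 z.2).

Lemma measurable_flow : measurable_fun setT (fun z : borelV R n * borelV R n =>
  \1_A z.1 * p z.1 * (\1_(~` A) z.2 * qd z.1 z.2)).
Proof.
apply: measurable_funM; apply: measurable_funM => //.
- exact: (measurableT_comp mA1).
- exact: (measurableT_comp mp).
- exact: (measurableT_comp mAC1).
Qed.

Let mswap : measurable_fun setT
  (fun z : borelV R n * borelV R n => (z.2, z.1) : borelV R n * borelV R n).
Proof. exact: measurable_fun_pair. Qed.

Let flow_ge0 z : 0 <= flow z.
Proof. by rewrite !mulr_ge0// ltW. Qed.

(** The squared increment of [f] vanishes unless exactly one of the two points is in [A], and then
    equals [(a * (1 - a))^-1]. Exits and entries contribute equal bounds, so the factor [2^-1] of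
    the Dirichlet form leaves a single flow. *)
Lemma dirichlet_normalized_indic :
  (dirichlet p qd f <= (a * (1 - a))^-1%:E *
    iint (fun x => iint (fun y =>
      (\1_A x * p x * (\1_(~` A) y * qd x y))%:E)))%E.
Proof.
pose K (z : borelV R n * borelV R n) := (f z.2 - f z.1) ^+ 2 *
  Num.min (p z.1 * qd z.1 z.2) (p z.2 * qd z.2 z.1).
have mf : measurable_fun (T := borelV R n) setT f.
  by apply: measurable_funM => //; exact: measurable_funB.
have mqd' : measurable_fun setT (fun z : borelV R n * borelV R n => qd z.2 z.1).
  exact: (measurableT_comp mqd mswap).
have mK : measurable_fun setT (EFin \o K).
  apply/measurable_EFinP; apply: measurable_funM.
    apply: measurable_funX; apply: measurable_funB.
      exact: (measurableT_comp mf).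
    exact: (measurableT_comp mf).
  apply: measurable_minr; apply: measurable_funM => //.
    exact: (measurableT_comp mp).
  exact: (measurableT_comp mp).
have K0 z : (0 <= (EFin \o K) z)%E.
  by rewrite lee_fin mulr_ge0 ?sqr_ge0// le_min !mulr_ge0// ltW.
(* The rejection atom sits at [y = x], where the increment is zero, so only the absolutely
   continuous part of the kernel remains. *)
have KE x : ((p x)%:E * mh_int p qd x (fun y => ((f y - f x) ^+ 2)%R))%E =
    iint (fun y => (K (x, y))%:E).
  rewrite /mh_int subrr expr0n mulr0 adde0.
  rewrite -iintZl/= ?lee_fin ?ltW//.
  - apply: eq_iint => y; rewrite /K /= -mh_acceptM -EFinM; congr EFin; ring.
  - apply: (eq_measurable_fun (fun y => ((p x)^-1%:E * (K (x, y))%:E)%E)).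
      move=> y _; rewrite /K/= -mh_acceptM -EFinM; congr EFin; field.
      by rewrite gt_eqF.
    apply: measurable_funeM.
    exact: (measurable_fun_pair2 (x : borelV R n) mK).
  - move=> y; rewrite lee_fin mulr_ge0 ?sqr_ge0// mulr_ge0//; last exact: ltW.
    by rewrite /mh_accept le_min ler01 divr_ge0// mulr_ge0// ltW.
have iflow0 x : (0 <= iint (fun y : 'rV[R]_n => (flow (x, y))%:E))%E.
  by apply: iint_ge0 => y; rewrite lee_fin.
have iflow0' x : (0 <= iint (fun y : 'rV[R]_n => (flow (y, x))%:E))%E.
  by apply: iint_ge0 => y; rewrite lee_fin.
have mflowE : measurable_fun setT (EFin \o flow).
  by apply/measurable_EFinP; exact: measurable_flow.
have mflowE' : measurable_fun setT
    (fun z : borelV R n * borelV R n => (flow (z.2, z.1))%:E).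
  exact: (measurableT_comp mflowE mswap).
have miflow : measurable_fun (T := borelV R n) setT
    (fun x => iint (fun y : 'rV[R]_n => (flow (x, y))%:E)).
  by apply: (measurable_iint mflowE) => z; rewrite lee_fin.
have miflow' : measurable_fun (T := borelV R n) setT
    (fun x => iint (fun y : 'rV[R]_n => (flow (y, x))%:E)).
  by apply: (measurable_iint mflowE') => z; rewrite lee_fin.
have sV : 0 <= (a * (1 - a))^-1 by rewrite invr_ge0 mulr_ge0// ?subr_ge0 ltW.
pose c := (a * (1 - a))^-1.
have le1 : (iint (fun x => iint (fun y => (K (x, y))%:E)) <=
   c%:E * (iint (fun x => iint (fun y => (flow (x, y))%:E)) +
           iint (fun x => iint (fun y => (flow (y, x))%:E))))%E.
  rewrite -iintD// -iintZl//; last 2 first.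
    exact: emeasurable_funD.
    by move=> x; rewrite adde_ge0.
  apply: le_iint.
  - exact: (measurable_iint mK).
  - by apply: measurable_funeM; exact: emeasurable_funD.
  - by move=> x; apply: iint_ge0 => y; exact: (K0 (x, y)).
  - move=> x; rewrite -iintD//=; last 4 first.
      exact: (measurable_fun_pair2 (x : borelV R n) mflowE).
      exact: (measurable_fun_pair2 (x : borelV R n) mflowE').
      by move=> y; rewrite lee_fin.
      by move=> y; rewrite lee_fin.
    have m12 : measurable_fun (T := borelV R n) setT
        (fun y => (flow (x, y))%:E + (flow (y, x))%:E)%E.
      apply: emeasurable_funD.
        exact: (measurable_fun_pair2 (x : borelV R n) mflowE).
      exact: (measurable_fun_pair2 (x : borelV R n) mflowE').
    rewrite -iintZl//; last by move=> y; rewrite adde_ge0// lee_fin.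
    apply: le_iint.
    + exact: (measurable_fun_pair2 (x : borelV R n) mK).
    + exact: measurable_funeM.
    + by move=> y; exact: (K0 (x, y)).
    move=> y; rewrite -EFinD -EFinM lee_fin /K /flow /=.
    rewrite /f /normalized_indic -mulrBl opprB addrA subrK exprMn exprVn ss.
    rewrite mulrAC mulrC -/c ler_wpM2l//.
    rewrite !indicE !in_setC.
    (* In the two mixed cases the minimum is bounded by the proposal flow that starts from whichever
       point belongs to [A]. *)
    case: (x \in A); case: (y \in A) => /=;
      rewrite ?(subrr, sub0r, subr0, sqrrN, expr1n, expr0n, mul0r, mul1r, mulr0,
                addr0, add0r)//=.
      by rewrite ge_min lexx.
    by rewrite ge_min lexx orbT.
rewrite /dirichlet; under eq_iint do rewrite KE.
have -> : (c%:E * iint (fun x : 'rV[R]_n => iint (fun y : 'rV[R]_n =>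
      (\1_A x * p x * (\1_(~` A) y * qd x y))%:E)) = 2^-1%:E *
   (c%:E * (iint (fun x => iint (fun y => (flow (x, y))%:E)) +
           iint (fun x => iint (fun y => (flow (y, x))%:E)))))%E.
  (* Exchanging the variables shows that both directions have the same integral [X]; half of [X + X]
     is then [X]. *)
  have := iint_swap mflowE (fun z => _ : (0 <= (flow z)%:E)%E).
  move=> /= <-; last by move=> z; rewrite lee_fin.
  rewrite muleCA; congr (_ * _)%E; set X := iint _.
  have X0 : (0 <= X)%E by apply: iint_ge0.
  rewrite ge0_muleDr// -ge0_muleDl// -EFinD.
  by rewrite (_ : 2^-1 + 2^-1 = 1) ?mul1e//; field.
by rewrite lee_pmul2l// lte_fin.
Qed.

Lemma Gap_le_flow : (Gap p qd <= (a * (1 - a))^-1%:E *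
    iint (fun x => iint (fun y =>
      (\1_A x * p x * (\1_(~` A) y * qd x y))%:E)))%E.
Proof.
apply: (le_trans _ dirichlet_normalized_indic).
by apply: ereal_inf_lbound; exists f => //; exact: L2_01_normalized_indic.
Qed.

End conductance.

(** * Densities on the line *)

Section line_integrals.
Context {R : realType}.
Notation mu := (@lebesgue_measure R).

Lemma lebesgue_measure_itvoc_scale (k a b : R) : k != 0 ->
  mu ((fun x => x / k) @^-1` `]a, b]) = (`|k|%:E * mu `]a, b]%classic)%E.
Proof.
move=> k0; have [k_gt0|k_lt0] : 0 < k \/ k < 0.
  by move: k0; rewrite neq_lt => /orP[|]; [right|left].
- have -> : (fun x => x / k) @^-1` `]a, b] = `](a * k), (b * k)]%classic.
    apply/seteqP; split => x /=; rewrite !in_itv/=.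
      by rewrite ltr_pdivlMr// ler_pdivrMr.
    by rewrite ltr_pdivlMr// ler_pdivrMr.
  rewrite !lebesgue_measure_itv/= !lte_fin ltr_pM2r// gtr0_norm//.
  by case: ifPn => _; rewrite ?mule0// -!EFinB -EFinM; congr EFin; ring.
- have -> : (fun x => x / k) @^-1` `]a, b] = `[(b * k), (a * k)[%classic.
    apply/seteqP; split => x /=; rewrite !in_itv/= andbC.
      by rewrite ltr_ndivlMr// ler_ndivrMr.
    by rewrite ltr_ndivlMr// ler_ndivrMr.
  rewrite !lebesgue_measure_itv/= !lte_fin ltr_nM2r// ltr0_norm//.
  by case: ifPn => _; rewrite ?mule0// -!EFinB -EFinM; congr EFin; ring.
Qed.

(** By uniqueness of Lebesgue measure it suffices to compare the rescaled pushforward with [mu] on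
    the intervals []a, b]]. Negative [k] is included because the reflection [k = -1] is needed
    besides the dilation by [lam]. *)
Lemma integral_scale (k : R) (h : R -> \bar R) : k != 0 ->
  measurable_fun setT h -> (forall x, 0 <= h x)%E ->
  (\int[mu]_x (`|k|^-1%:E * h (x / k)%R) = \int[mu]_x h x)%E.
Proof.
move=> k0 mh h0.
have mk : measurable_fun (T := measurableTypeR R) (U := measurableTypeR R) setT
    (fun x : R => x / k).
  exact: (@measurable_funM _ _ R setT id (cst k^-1)).
pose push := pushforward mu (fun x : measurableTypeR R => x / k : measurableTypeR R)
  : {measure set (measurableTypeR R) -> \bar R}.
have kV : 0 <= `|k|^-1 by rewrite invr_ge0.
pose nu := mscale (NngNum kV) (push mk)
  : {measure set (measurableTypeR R) -> \bar R}.
have muE A : measurable A -> mu A = nu A.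
  apply: lebesgue_measure_unique => _ [[a b] _ <-] /=.
  rewrite /nu /mscale /= /pushforward/= lebesgue_measure_itvoc_scale//.
  by rewrite muleA -EFinM mulVf ?mul1e// normr_eq0.
have -> : (\int[mu]_x h x = \int[nu]_x h x)%E.
  by apply: eq_measure_integral => A mA _; exact: muE.
rewrite ge0_integral_mscale//= ge0_integral_pushforward//=.
rewrite preimage_setT ge0_integralZl//.
exact: (measurableT_comp mh).
Qed.

Lemma measurable_norm_ge (r : R) : measurable [set u : R | r <= `|u|].
Proof.
have -> : [set s : R | r <= `|s|] = (@Num.norm R R) @^-1` `[r, +oo[.
  by apply/seteqP; split => s /=; rewrite in_itv/= andbT.
rewrite -[X in measurable X]setTI.
by have : measurable_fun setT (@Num.norm R R) by []; apply.
Qed.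

(** On the compact interval [f] attains a minimum, which is positive; minimum times length bounds
    the integral from below. *)
Lemma integral_indic_gt0 (f : R -> R) (D : set R) (x y : R) :
  continuous f -> (forall t, 0 < f t) -> measurable D -> x < y ->
  `[x, y] `<=` D -> (0 < \int[mu]_t (\1_D t * f t)%:E)%E.
Proof.
move=> cf f0 mD xy xyD.
have cfxy : {within `[x, y], continuous f}.
  by apply: continuous_subspaceT => z; exact: cf.
have [z _ zmin] := EVT_min (ltW xy) cfxy.
have mf : measurable_fun setT f by exact: continuous_measurable_fun.
have : (0 < (f z)%:E * mu `[x, y]%classic)%E.
  by rewrite lebesgue_measure_itv/= lte_fin xy -EFinB -EFinM lte_fin mulr_gt0// subr_gt0.
move/lt_le_trans; apply.
rewrite -[X in mu X]setIT -integral_indic// -ge0_integralZl//; last 2 first.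
- by apply/measurable_EFinP; exact: measurable_indic.
- by rewrite lee_fin ltW.
apply: ge0_le_integral => //.
- by move=> t _; rewrite -EFinM lee_fin mulr_ge0// ltW.
- by apply: measurable_funeM; apply/measurable_EFinP; exact: measurable_indic.
- by apply/measurable_EFinP; apply: measurable_funM => //; exact: measurable_indic.
- move=> t _; rewrite -EFinM lee_fin !indicE.
  have [txy|] := boolP (t \in _); last first.
    by rewrite mulr0 mulr_ge0// ltW.
  rewrite mulr1 (_ : t \in D = true) ?mul1r; last first.
    by apply/mem_set/xyD/set_mem.
  by apply: zmin; move: txy; rewrite inE.
Qed.

End line_integrals.

(** * Exponential tails from a logarithmic derivative bounded away from zero *)

Section log_density_tail.
Context {R : realType}.
Notation mu := (@lebesgue_measure R).
Variables (f g : R -> R) (c M : R).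
Hypothesis f_gt0 : forall t, 0 < f t.
Hypothesis mf : measurable_fun setT f.
Hypothesis f1 : (\int[mu]_t (f t)%:E = 1)%E.
Hypothesis dlnf : forall t : R, is_derive t 1 (fun s => ln (f s)) (g t).
Hypothesis cg : continuous g.
Hypothesis c_gt0 : 0 < c.
Hypothesis g_ge : forall t, M <= `|t| -> c <= `|g t|.

Section one_sided.
(** [e] is [1] or [-1]; evaluating at [t * e] treats the right and the left tail by one argument. *)
Variable e : R.
Hypothesis e1 : `|e| = 1.

Let normM t : M <= t -> M <= `|t * e|.
Proof. by move=> Mt; rewrite normrM e1 mulr1 (le_trans Mt)// ler_norm. Qed.

Let ee : e * e = 1.
Proof. by rewrite -expr2 -real_normK ?num_real// e1 expr1n. Qed.

Let dphi (t : R) : is_derive t 1 (fun s => ln (f (s * e))) (g (t * e) * e).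
Proof.
have d1 : is_derive t 1 (fun s => s * e) e.
  by apply: is_derive_eq; rewrite /GRing.scale/=; ring.
exact: (is_derive1_comp (dlnf _) d1).
Qed.

Let cphi : continuous (fun s : R => ln (f (s * e))).
Proof.
move=> t; apply: differentiable_continuous; apply/derivable1_diffP.
exact: ex_derive.
Qed.

Let cG : continuous (fun t : R => g (t * e) * e).
Proof.
move=> t; apply: cvgM; last exact: cvg_cst.
apply: (cvg_comp (fun s => s * e) g); last exact: cg.
by apply: cvgM; [exact: cvg_id|exact: cvg_cst].
Qed.

(** A change of sign on the half-line would give a zero by the intermediate value theorem, against
    the lower bound [c] on the absolute value. *)
Let sign_G : (forall t, M <= t -> g (t * e) * e <= - c) \/
             (forall t, M <= t -> c <= g (t * e) * e).
Proof.
have absG t : M <= t -> c <= `|g (t * e) * e|.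
  by move=> /normM /g_ge; rewrite normrM e1 mulr1.
apply: contrapT => /not_orP[/existsNP[t0 /not_implyP[Mt0 /negP]]].
rewrite -ltNge => Gt0 /existsNP[t1 /not_implyP[Mt1 /negP]].
rewrite -ltNge => Gt1.
have {}Gt0 : 0 < g (t0 * e) * e.
  by move: (absG _ Mt0); rewrite ler_normr => /orP[] h; have := c_gt0; lra.
have {}Gt1 : g (t1 * e) * e < 0.
  by move: (absG _ Mt1); rewrite ler_normr => /orP[] h; have := c_gt0; lra.
have cw a b : {within `[a, b], continuous (fun t : R => g (t * e) * e)}.
  by apply: continuous_subspaceT => z; exact: cG.
suff [t Mt Gt] : exists2 t, M <= t & g (t * e) * e = 0.
  by have := absG _ Mt; rewrite Gt normr0 => h; have := c_gt0; lra.
have [t01|t10] := leP t0 t1.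
  have [|t] := IVT (v := 0) t01 (cw _ _).
    by rewrite ge_min le_max (ltW Gt0) (ltW Gt1) orbT.
  rewrite in_itv/= => /andP[t0t _] Gt.
  by exists t => //; exact: le_trans t0t.
have [|t] := IVT (v := 0) (ltW t10) (cw _ _).
  by rewrite ge_min le_max (ltW Gt0) (ltW Gt1) orbT.
rewrite in_itv/= => /andP[t0t _] Gt.
by exists t => //; exact: le_trans t0t.
Qed.

Let mvt t : M < t -> exists2 s, M <= s &
  ln (f (t * e)) - ln (f (M * e)) = g (s * e) * e * (t - M).
Proof.
move=> Mt; have [|s] := MVT Mt (fun x _ => dphi x).
  by apply: continuous_subspaceT => z; exact: cphi.
by rewrite in_itv/= => /andP[Ms _] ->; exists s => //; exact: ltW.
Qed.

(* If the logarithmic derivative pointed outwards, [f] would be bounded below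
   on a half-line and could not be integrable. *)
Lemma log_density_le t : M <= t -> f (t * e) <= f (M * e) * expR (- c * (t - M)).
Proof.
rewrite le_eqVlt => /predU1P[<-|Mt]; first by rewrite subrr mulr0 expR0 mulr1.
have [Gle|Gge] := sign_G.
  have [s Ms E] := mvt Mt.
  rewrite -[leLHS]lnK ?posrE// -[f (M * e)]lnK ?posrE// -expRD ler_expR.
  rewrite -lerBlDl E ler_wpM2r ?subr_ge0 ?(ltW Mt)//; exact: Gle.
exfalso.
have fge s : M <= s -> f (M * e) <= f (s * e).
  rewrite le_eqVlt => /predU1P[<-//|Ms].
  have [r Mr E] := mvt Ms.
  rewrite -ler_ln ?posrE// -subr_ge0 E mulr_ge0 ?subr_ge0 ?(ltW Ms)//.
  exact: le_trans (ltW c_gt0) (Gge _ Mr).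
pose D := [set s : R | M <= s * e].
have mD : measurable D.
  have -> : D = (fun s => s * e) @^-1` `[M, +oo[.
    by apply/seteqP; split => s /=; rewrite in_itv/= andbT.
  rewrite -[X in measurable X]setTI.
  suff : measurable_fun setT (fun s : R => s * e) by apply.
  exact: measurable_funM.
have muD : mu D = +oo%E.
  have [e_eq|e_eq] : e = 1 \/ e = -1.
    by move: e1; case: ger0P => e0 h; [left|right; lra].
  - have -> : D = `[M, +oo[%classic.
      by apply/seteqP; split => s /=; rewrite /D /= in_itv/= andbT e_eq mulr1.
    by rewrite lebesgue_measure_itv/= ltry.
  - have -> : D = `]-oo, (- M)]%classic.
      by apply/seteqP; split => s /=; rewrite /D /= in_itv/= e_eq mulrN1 lerNr.
    by rewrite lebesgue_measure_itv/= ltNyr.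
have : ((f (M * e))%:E * mu D <= 1)%E.
  rewrite -f1 -[X in mu X]setIT -integral_indic// -ge0_integralZl//; last 2 first.
  - by apply/measurable_EFinP; exact: measurable_indic.
  - by rewrite lee_fin ltW.
  apply: ge0_le_integral => //.
  - by move=> s _; rewrite -EFinM lee_fin mulr_ge0// ltW.
  - by apply: measurable_funeM; apply/measurable_EFinP; exact: measurable_indic.
  - exact/measurable_EFinP.
  - move=> s _; rewrite -EFinM lee_fin indicE.
    have [|_] := boolP (s \in D); last by rewrite mulr0 ltW.
    rewrite inE mulr1 /D /= => /fge; rewrite -mulrA ee mulr1 => h.
    exact: h.
by rewrite muD gt0_muley// lte_fin.
Qed.

End one_sided.

(** Half of the decay rate is spent on [U]: for [|t| >= U], [expR (- c * |t|)] is at most [expR (-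
    (c / 2) * U) * expR (- (c / 2) * |t|)]. The remaining factor is dominated by [2 / c] times two
    mirrored exponential densities of rate [c / 2], of total mass [2]; hence the [4 / c]. *)
Lemma integral_tail_le U : M <= U ->
  (\int[mu]_t (\1_[set s : R | U <= `|s|] t * f t)%:E <=
   ((f M + f (- M)) * expR (c * M) * (4 / c) * expR (- (c / 2) * U))%:E)%E.
Proof.
move=> MU; pose E : R -> R := exponential_pdf (c / 2).
have c20 : 0 < c / 2 by rewrite divr_gt0.
have mE : measurable_fun setT E by exact: measurable_exponential_pdf.
have E0 (t : R) : 0 <= E t by apply: exponential_pdf_ge0; exact: ltW.
have mEN : measurable_fun setT (fun t : R => E (- t)) by exact: (measurableT_comp mE).
have iE : (\int[mu]_t (E t)%:E = 1)%E by exact: integral_exponential_pdf.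
have iEN : (\int[mu]_t (E (- t))%:E = 1)%E.
  rewrite -iE -(@integral_scale _ (-1) (fun t => (E t)%:E)) ?oppr_eq0//.
  - apply: eq_integral => t _; rewrite normrN1 invr1 mul1e.
    by rewrite invrN1 mulrN1.
  - exact/measurable_EFinP.
pose K := (f M + f (- M)) * expR (c * M) * (2 / c) * expR (- (c / 2) * U).
have K0 : 0 <= K.
  by rewrite /K !mulr_ge0 ?invr_ge0 ?expR_ge0 ?addr_ge0 ?ltW.
have -> : (((f M + f (- M)) * expR (c * M) * (4 / c) * expR (- (c / 2) * U))%:E =
    K%:E * \int[mu]_t ((E t)%:E + (E (- t))%:E))%E.
  rewrite ge0_integralD ?iE ?iEN//; last 4 first.
  - by move=> t _; rewrite lee_fin.
  - exact/measurable_EFinP.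
  - by move=> t _; rewrite lee_fin.
  - exact/measurable_EFinP.
  by rewrite -EFinD -EFinM /K; congr EFin; field; rewrite gt_eqF.
have mEE : measurable_fun setT (fun t : R => (E t)%:E + (E (- t))%:E)%E.
  by apply: emeasurable_funD; exact/measurable_EFinP.
rewrite -ge0_integralZl//; last by move=> t _; rewrite adde_ge0// lee_fin.
have mD := measurable_norm_ge U.
apply: ge0_le_integral => //.
- by move=> t _; rewrite lee_fin mulr_ge0// ltW.
- by apply/measurable_EFinP; apply: measurable_funM => //; exact: measurable_indic.
- exact: measurable_funeM.
move=> t _; rewrite -EFinD -EFinM lee_fin indicE.
have [|_] := boolP (t \in _); last by rewrite mul0r mulr_ge0// addr_ge0.
rewrite inE/= mul1r => Ut.
have Et : c / 2 * expR (- (c / 2) * `|t|) <= E t + E (- t).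
  have [t0|t0] := leP 0 t.
    by rewrite -[leLHS]addr0 ger0_norm// lerD// /E exponential_pdfE.
  rewrite -[leLHS]add0r ltr0_norm// lerD// /E exponential_pdfE//.
  by rewrite oppr_ge0 ltW.
apply: (@le_trans _ _ (K * (c / 2 * expR (- (c / 2) * `|t|)))); last first.
  exact: ler_wpM2l.
(* The sum of the two endpoint values covers both signs of [t] at once. *)
have ft : f t <= (f M + f (- M)) * expR (- c * (`|t| - M)).
  have Mt := le_trans MU Ut.
  have [t0|t0] := leP 0 t.
    have := log_density_le (normr1 R) (t := t).
    rewrite !mulr1 -{1}(ger0_norm t0) => /(_ Mt) /le_trans; apply.
    by rewrite ger0_norm// ler_wpM2r ?expR_ge0// lerDl ltW.
  have := @log_density_le (-1) (normrN1 R) (- t).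
  rewrite !mulrN1 opprK -{1}(ltr0_norm t0) => /(_ Mt) /le_trans; apply.
  by rewrite ltr0_norm// ler_wpM2r ?expR_ge0// lerDr ltW.
apply: (le_trans ft); rewrite /K.
rewrite (_ : _ * (c / 2 * _) = (f M + f (- M)) *
    (expR (c * M) * expR (- (c / 2) * U) * expR (- (c / 2) * `|t|))); last first.
  by field; rewrite gt_eqF.
apply: ler_wpM2l; first by rewrite addr_ge0 ?ltW.
rewrite -2!expRD ler_expR.
have : c / 2 * U <= c / 2 * `|t| by rewrite ler_wpM2l// ltW.
lra.
Qed.

End log_density_tail.

(** * MALA proposals and scaled product targets *)

Section gaussian_proposal.
Context {R : realType}.
Notation mu := (@lebesgue_measure R).
Variable sigma : R.
Hypothesis sigma_gt0 : 0 < sigma.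

Definition gauss_prod n (m y : 'rV[R]_n) : R :=
  \prod_(i < n) normal_pdf (m 0 i) sigma (y 0 i).

Definition mala_mean n (p : 'rV[R]_n -> R) (x : 'rV[R]_n) : 'rV[R]_n :=
  x + (sigma ^+ 2 / 2) *: grad (fun z => ln (p z)) x.

Lemma mala_densityE n (p : 'rV[R]_n -> R) x y :
  mala_density p sigma x y = gauss_prod (mala_mean p x) y.
Proof.
rewrite /mala_density /gauss_prod.
under eq_bigr do rewrite normal_pdfE ?gt_eqF// /normal_fun.
rewrite big_split/= prodr_const card_ord -expR_sum; congr (_ * expR _).
  rewrite /normal_peak exprVn; congr (_ ^- _); congr Num.sqrt.
  by ring.
rewrite /sqnorm -/(mala_mean p x) -sumrN big_distrl/=; apply: eq_bigr => i _.
rewrite !mxE; congr (_ / _).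
by rewrite mulr_natl.
Qed.

Lemma gauss_prod_ge0 n (m y : 'rV[R]_n) : 0 <= gauss_prod m y.
Proof. by apply: prodr_ge0 => i _; exact: normal_pdf_ge0. Qed.

Lemma mala_density_gt0 n (p : 'rV[R]_n -> R) x y : 0 < mala_density p sigma x y.
Proof.
rewrite mulr_gt0 ?expR_gt0// invr_gt0 exprn_gt0// sqrtr_gt0.
by rewrite !mulr_gt0 ?pi_gt0// exprn_gt0.
Qed.

Lemma measurable_gauss_prod n (m : 'rV[R]_n) :
  measurable_fun (T := borelV R n) setT (gauss_prod m).
Proof.
apply: measurable_prod => i _.
exact: (measurableT_comp (measurable_normal_pdf _ _) (measurable_coord i)).
Qed.

Lemma gauss_prodS n (m y : 'rV[R]_n.+1) : gauss_prod m y =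
  normal_pdf (m 0 ord0) sigma (y 0 ord0) * gauss_prod (tailv m) (tailv y).
Proof.
rewrite /gauss_prod big_ord_recl; congr (_ * _).
by apply: eq_bigr => i _; rewrite !mxE.
Qed.

Lemma iint_gauss_prod n (m : 'rV[R]_n) : iint (fun y => (gauss_prod m y)%:E) = 1%E.
Proof.
elim: n m => [|n ih] m; first by rewrite /= /gauss_prod big_ord0.
under eq_iint do rewrite gauss_prodS EFinM.
rewrite (iint_prod (h := fun t => (normal_pdf (m 0 ord0) sigma t)%:E)
  (k := fun y => (gauss_prod (tailv m) y)%:E)).
- by rewrite ih mule1 integral_normal_pdf// gt_eqF.
- by apply/measurable_EFinP; exact: measurable_normal_pdf.
- by apply/measurable_EFinP; exact: measurable_gauss_prod.
- by move=> t; rewrite lee_fin normal_pdf_ge0.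
- by move=> t; rewrite lee_fin gauss_prod_ge0.
Qed.

(** The components of the proposal are independent, so the coordinates other than the first
    integrate to [1], although the mean depends on all of [x]. *)
Lemma iint_mala_head n (p : 'rV[R]_n.+1 -> R) x (h : R -> R) :
  measurable_fun setT h -> (forall t, 0 <= h t) ->
  iint (fun y => (h (y 0 ord0) * mala_density p sigma x y)%:E) =
  (\int[mu]_t (h t * normal_pdf (mala_mean p x 0 ord0) sigma t)%:E)%E.
Proof.
move=> mh h0; set m := mala_mean p x.
have -> : (fun y : 'rV[R]_n.+1 => (h (y 0 ord0) * mala_density p sigma x y)%:E) =
    (fun y : 'rV[R]_n.+1 => (h (y 0 ord0) * normal_pdf (m 0 ord0) sigma (y 0 ord0))%:E *
              (gauss_prod (tailv m) (tailv y))%:E)%E.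
  by apply/funext => y; rewrite mala_densityE gauss_prodS -EFinM mulrA.
rewrite (iint_prod (h := fun t => (h t * normal_pdf (m 0 ord0) sigma t)%:E)
  (k := fun y => (gauss_prod (tailv m) y)%:E)).
- by rewrite iint_gauss_prod mule1.
- apply/measurable_EFinP; apply: measurable_funM => //.
  exact: measurable_normal_pdf.
- by apply/measurable_EFinP; exact: measurable_gauss_prod.
- by move=> t; rewrite lee_fin mulr_ge0// normal_pdf_ge0.
- by move=> t; rewrite lee_fin gauss_prod_ge0.
Qed.

Lemma measurable_mala_density n (p : 'rV[R]_n -> R) :
  (forall i, measurable_fun (T := borelV R n) setT
     (fun x => grad (fun z => ln (p z)) x 0 i)) ->
  measurable_fun setT
    (fun z : borelV R n * borelV R n => mala_density p sigma z.1 z.2).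
Proof.
move=> mgrad; apply: measurable_funM => //.
apply: (@measurableT_comp _ _ _ _ _ _ expR) => //.
apply: measurable_funM => //; apply: (@measurableT_comp _ _ _ _ _ _ (@GRing.opp R)) => //.
apply: measurable_sum => i; apply: measurable_funX.
pose u (x : borelV R n) := x 0 i + sigma ^+ 2 / 2 * grad (fun z => ln (p z)) x 0 i.
have mu_x : measurable_fun setT u.
  apply: measurable_funD; first exact: measurable_coord.
  by apply: measurable_funM => //; exact: mgrad.
apply: (eq_measurable_fun (fun z : borelV R n * borelV R n => z.2 0 i - u z.1)).
  by move=> z _; rewrite /u !mxE.
apply: measurable_funB; first exact: (measurableT_comp (measurable_coord i)).
exact: (measurableT_comp mu_x).
Qed.

(** All points of the interval are at distance at least [b] from the mean, so the density is at most
    its peak times the exponential factor; multiply by the length [2 * r]. *)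
Lemma normal_interval_le (m r b : R) : 0 <= r -> 0 <= b -> r + b <= `|m| ->
  (\int[mu]_t (\1_[set s : R | `|s| < r] t * normal_pdf m sigma t)%:E <=
   (normal_peak sigma * (2 * r) * expR (- b ^+ 2 / (sigma ^+ 2 *+ 2)))%:E)%E.
Proof.
move=> r0 b0 rbm.
have -> : [set s : R | `|s| < r] = `]- r, r[%classic.
  by apply/seteqP; split => s /=; rewrite in_itv/= ltr_norml.
set K := normal_peak sigma * expR (- b ^+ 2 / (sigma ^+ 2 *+ 2)).
have K0 : 0 <= K by rewrite mulr_ge0 ?normal_peak_ge0 ?expR_ge0.
apply: (@le_trans _ _ (\int[mu]_t (K%:E * (\1_`]- r, r[ t)%:E))%E).
  apply: ge0_le_integral => //.
  - by move=> t _; rewrite lee_fin mulr_ge0// normal_pdf_ge0.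
  - apply/measurable_EFinP; apply: measurable_funM => //.
    exact: measurable_normal_pdf.
  - by apply: measurable_funeM; apply/measurable_EFinP; exact: measurable_indic.
  - move=> t _; rewrite -EFinM lee_fin indicE.
    have [|_] := boolP (t \in _); last by rewrite mul0r mulr0.
    rewrite inE /= in_itv/= -ltr_norml mul1r mulr1 => tr.
    rewrite normal_pdfE ?gt_eqF// /normal_fun ler_wpM2l ?normal_peak_ge0//.
    rewrite ler_expR ler_wpM2r ?invr_ge0 ?mulrn_wge0 ?sqr_ge0// lerN2.
    rewrite -[leRHS]real_normK ?num_real// lerXn2r ?nnegrE//.
    have := ler_distD t m 0; rewrite !subr0 distrC.
    move: tr rbm; lra.
rewrite ge0_integralZl//; last first.
  by apply/measurable_EFinP; exact: measurable_indic.
rewrite integral_indic// setIT.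
rewrite [X in (_ * X <= _)%E](lebesgue_measure_itv `]- r, r[)/= lte_fin.
case: ifPn => _; last by rewrite mule0 lee_fin !mulr_ge0 ?normal_peak_ge0 ?expR_ge0.
by rewrite -EFinB -EFinM lee_fin /K le_eqVlt; apply/orP; left; apply/eqP; ring.
Qed.

End gaussian_proposal.

(** * Regularity of the first factor and gradient of the scaled target *)

Section scaled_product_target.
Context {R : realType}.

(** Comparing increments rather than values lets additive constants cancel, such as [ln (p2 _)]
    along the first axis or [ln lam^-1], and lets a partial derivative be traded for an ordinary
    one. *)
Lemma eq_derive_line (V W : normedModType R) (f : V -> R) (g : W -> R) x v y w :
  (forall h : R, f (h *: v + x) - f x = g (h *: w + y) - g y) ->
  (derivable f x v -> derivable g y w) * ('D_v f x = 'D_w g y).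
Proof.
move=> fg; rewrite /derivable /derive.
have -> : (fun h : R => h^-1 *: ((f \o shift x) (h *: v) - f x)) =
          (fun h => h^-1 *: ((g \o shift y) (h *: w) - g y)).
  by apply/funext => h; rewrite /= fg.
by [].
Qed.

Variables (n : nat) (p : 'rV[R]_n.+1 -> R) (p1 : R -> R) (p2 : 'rV[R]_n -> R).
Hypothesis p_gt0 : forall x, 0 < p x.
Hypothesis p1_ge0 : forall t, 0 <= p1 t.
Hypothesis p2_ge0 : forall y, 0 <= p2 y.
Hypothesis pE : forall x, p x = p1 (x 0 ord0) * p2 (tailv x).
Hypothesis lnp_C1 : C1 (fun x => ln (p x)).

Let cons0 (t : R) : 'rV[R]_n.+1 := row_mx (const_mx t : 'rV[R]_1) (0 : 'rV[R]_n).

Lemma factor1_gt0 t : 0 < p1 t.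
Proof.
rewrite lt_neqAle p1_ge0 andbT eq_sym; apply/eqP => p10.
by have := p_gt0 (cons0 t); rewrite pE row_mx_cons0 p10 mul0r ltxx.
Qed.

Lemma factor2_gt0 y : 0 < p2 y.
Proof.
rewrite lt_neqAle p2_ge0 andbT eq_sym; apply/eqP => p20.
have := p_gt0 (row_mx (const_mx 0 : 'rV[R]_1) y).
by rewrite pE tailv_cons p20 mulr0 ltxx.
Qed.

Let lnpE x : ln (p x) = ln (p1 (x 0 ord0)) + ln (p2 (tailv x)).
Proof. by rewrite pE lnM ?posrE ?factor1_gt0 ?factor2_gt0. Qed.

Let tailv_evec0 (h : R) (x : 'rV[R]_n.+1) :
  tailv (h *: evec R ord0 + x) = tailv x.
Proof. by apply/rowP => j; rewrite !mxE /= mulr0 add0r. Qed.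

Let head_evec0 (h : R) (x : 'rV[R]_n.+1) :
  (h *: evec R ord0 + x) 0 ord0 = h + x 0 ord0.
Proof. by rewrite !mxE !eqxx mulr1. Qed.

(** Along the first axis [ln p] and [ln p1] differ by a constant, so [p1] inherits its
    differentiability from [p]. *)
Lemma derive_lnp_head x :
  (derivable (fun x => ln (p x)) x (evec R ord0) ->
     derivable (fun t => ln (p1 t)) (x 0 ord0) 1) *
  ('D_(evec R ord0) (fun x => ln (p x)) x = (derive1 (fun t => ln (p1 t))) (x 0 ord0)).
Proof.
rewrite derive1E; apply: eq_derive_line => h.
by rewrite !lnpE tailv_evec0 head_evec0 /GRing.scale/= mulr1; ring.
Qed.

Lemma is_derive_lnp1 (t : R) :
  is_derive t 1 (fun s => ln (p1 s)) ((derive1 (fun s => ln (p1 s))) t).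
Proof.
have d : derivable (fun s => ln (p1 s)) t 1.
  have [H _] := derive_lnp_head (cons0 t).
  have := H ((lnp_C1 ord0).1 _); by rewrite row_mx_cons0.
by rewrite derive1E; exact/derivableP.
Qed.

Let continuous_cons0 : continuous cons0.
Proof.
move=> t A /nbhs_ballP[e e0 eA]; apply/nbhs_ballP; exists e => //= s ts.
apply: eA; split => // i j; rewrite ord1; case: (unliftP ord0 j) => [k|] ->.
  by rewrite !row_mx_consS; exact: ballxx.
by rewrite !row_mx_cons0.
Qed.

Lemma continuous_derive_lnp1 : continuous (derive1 (fun s => ln (p1 s))).
Proof.
have -> : (derive1 (fun s => ln (p1 s))) =
    (fun x => 'D_(evec R ord0) (fun x => ln (p x)) x) \o cons0.
  apply/funext => t /=.
  by rewrite (derive_lnp_head _).2 row_mx_cons0.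
move=> t; apply: continuous_comp; first exact: continuous_cons0.
exact: (lnp_C1 ord0).2.
Qed.

Lemma continuous_lnp1 : continuous (fun s => ln (p1 s)).
Proof.
move=> t; apply: differentiable_continuous; apply/derivable1_diffP.
by have := is_derive_lnp1 t => h; exact: ex_derive.
Qed.

Lemma continuous_factor1 : continuous p1.
Proof.
have -> : p1 = expR \o (fun s => ln (p1 s)).
  by apply/funext => t; rewrite /= lnK// posrE factor1_gt0.
move=> t; apply: continuous_comp; first exact: continuous_lnp1.
exact: continuous_expR.
Qed.

Variable lam : R.
Hypothesis lam_gt0 : 0 < lam.

Let dil (x : 'rV[R]_n.+1) : 'rV[R]_n.+1 :=
  \row_j (if j == ord0 then x 0 j / lam else x 0 j).

Let measurable_dil : measurable_fun (T := borelV R n.+1) (U := borelV R n.+1)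
  setT dil.
Proof.
apply: measurable_fun_rV => i; under eq_fun do rewrite mxE.
case: (i == ord0); last exact: measurable_coord.
by apply: measurable_funM => //; exact: measurable_coord.
Qed.

Lemma scale_targetE x : scale_target lam p x =
  lam^-1 * p1 (x 0 ord0 / lam) * p2 (tailv x).
Proof.
rewrite /scale_target pE !mxE eqxx mulrA; congr (_ * p2 _).
by apply/rowP => j; rewrite !mxE.
Qed.

Lemma scale_target_gt0 x : 0 < scale_target lam p x.
Proof. by rewrite mulr_gt0 ?invr_gt0. Qed.

Lemma measurable_scale_target : borel_fun p ->
  measurable_fun (T := borelV R n.+1) setT (scale_target lam p).
Proof.
move=> /borel_fun_measurable mp; apply: measurable_funM => //.
exact: (measurableT_comp mp measurable_dil).
Qed.

Let ln_scale_target x : ln (scale_target lam p x) =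
  ln lam^-1 + ln (p1 (x 0 ord0 / lam)) + ln (p2 (tailv x)).
Proof.
by rewrite scale_targetE !lnM ?posrE ?mulr_gt0 ?invr_gt0 ?factor1_gt0 ?factor2_gt0.
Qed.

(** The chain rule factor [lam^-1] is the source of the overshooting drift. *)
Lemma grad_scale_target_head x :
  grad (fun z => ln (scale_target lam p z)) x 0 ord0 =
  lam^-1 * (derive1 (fun s => ln (p1 s))) (x 0 ord0 / lam).
Proof.
rewrite mxE.
pose lnp1 (s : R) := ln (p1 (s / lam)).
have E (h : R) : ln (scale_target lam p (h *: evec R ord0 + x)) -
    ln (scale_target lam p x) = lnp1 (h *: 1 + x 0 ord0) - lnp1 (x 0 ord0).
  by rewrite !ln_scale_target tailv_evec0 head_evec0 /lnp1 /GRing.scale/= mulr1; ring.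
rewrite (eq_derive_line E).2.
have d1 : is_derive (x 0 ord0) 1 (fun s : R => s / lam) lam^-1.
  by apply: is_derive_eq; rewrite /GRing.scale/=; ring.
have d2 := @is_derive1_comp R (fun s => ln (p1 s)) (fun s => s / lam)
  (x 0 ord0) _ _ (is_derive_lnp1 _) d1.
by rewrite mulrC; exact: derive_val.
Qed.

Lemma grad_scale_target_tail x j :
  grad (fun z => ln (scale_target lam p z)) x 0 (lift ord0 j) =
  'D_(evec R (lift ord0 j)) (fun z => ln (p z)) (dil x).
Proof.
rewrite mxE; apply: (eq_derive_line _).2 => h.
rewrite /scale_target !lnM ?posrE ?invr_gt0// opprD addrACA subrr add0r.
congr (ln (p _) - _); apply/rowP => k; rewrite !mxE.
case: (unliftP ord0 k) => [i|] -> //=.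
by rewrite ?eqxx ?mulr0 ?add0r.
Qed.

Lemma measurable_grad_scale_target i :
  measurable_fun (T := borelV R n.+1) setT
    (fun x => grad (fun z => ln (scale_target lam p z)) x 0 i).
Proof.
case: (unliftP ord0 i) => [j|] ->.
  under eq_fun do rewrite grad_scale_target_tail.
  exact: (measurableT_comp (continuous_borelV (lnp_C1 (lift ord0 j)).2)
    measurable_dil).
under eq_fun do rewrite grad_scale_target_head.
have m1 : measurable_fun setT (derive1 (fun s => ln (p1 s))).
  by apply: continuous_measurable_fun; exact: continuous_derive_lnp1.
have m2 : measurable_fun (T := borelV R n.+1) setT (fun x => x 0 ord0 / lam).
  by apply: measurable_funM => //; exact: measurable_coord.
apply: measurable_funM => //; exact: (measurableT_comp m1 m2).
Qed.

End scaled_product_target.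

(** * Gap bound *)

Section gap_bound.
Context {R : realType} (n : nat).
Notation mu := (@lebesgue_measure R).
Variables (p : 'rV[R]_n.+1 -> R) (p1 : R -> R) (p2 : 'rV[R]_n -> R).
Variables (sigma c M : R).
Hypothesis bp : borel_fun p.
Hypothesis p_gt0 : forall x, 0 < p x.
Hypothesis dp1 : density1 p1.
Hypothesis dp2 : densityn p2.
Hypothesis pE : forall x, p x = p1 (x 0 ord0) * p2 (tailv x).
Hypothesis lnp_C1 : C1 (fun x => ln (p x)).
Hypothesis sigma_gt0 : 0 < sigma.
Hypothesis c_gt0 : 0 < c.
Hypothesis M_ge1 : 1 <= M.
Notation g := (derive1 (fun s => ln (p1 s))).
Hypothesis g_ge : forall t, M <= `|t| -> c <= `|g t|.

Let mp1 : measurable_fun setT p1. Proof. by case: dp1. Qed.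
Let p1_ge0 t : 0 <= p1 t. Proof. by case: dp1 => _ []. Qed.
Let ip1 : (\int[mu]_t (p1 t)%:E = 1)%E. Proof. by case: dp1 => _ []. Qed.
Let p2_ge0 y : 0 <= p2 y. Proof. by case: dp2 => _ []. Qed.
Let p1_gt0 t : 0 < p1 t. Proof. exact: (factor1_gt0 p_gt0 p1_ge0 pE). Qed.

Let D : set R := [set u | M <= `|u|].

Let mD : measurable D. Proof. exact: measurable_norm_ge. Qed.

(** [p1] is continuous and positive, and both [D] and its complement contain a nondegenerate
    interval: [[M, M + 1]], and [[0, 1 / 2]] because [M >= 1]. *)
Let mass_outside : exists a : R, [/\ 0 < a, a < 1 &
  (\int[mu]_t (\1_D t * p1 t)%:E = a%:E)%E].
Proof.
have cp1 := continuous_factor1 p_gt0 p1_ge0 p2_ge0 pE lnp_C1.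
have mDC : measurable (~` D) by exact: measurableC.
have M0 : 0 <= M by exact: le_trans M_ge1.
have gt0D : (0 < \int[mu]_t (\1_D t * p1 t)%:E)%E.
  apply: (@integral_indic_gt0 _ _ _ M (M + 1)) => //; first by rewrite ltrDl.
  move=> t /=; rewrite in_itv/= /D => /andP[Mt _].
  by rewrite /= (le_trans Mt)// ler_norm.
have gt0DC : (0 < \int[mu]_t (\1_(~` D) t * p1 t)%:E)%E.
  apply: (@integral_indic_gt0 _ _ _ 0 2^-1) => //.
  move=> t /=; rewrite in_itv/= /D => /andP[t0 t1]; apply/negP.
  by rewrite -ltNge ger0_norm//; move: M_ge1; lra.
have : (\int[mu]_t (\1_D t * p1 t)%:E + \int[mu]_t (\1_(~` D) t * p1 t)%:E = 1)%E.
  rewrite -ge0_integralD//; last 4 first.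
  - by move=> t _; rewrite lee_fin mulr_ge0.
  - by apply/measurable_EFinP; apply: measurable_funM => //; exact: measurable_indic.
  - by move=> t _; rewrite lee_fin mulr_ge0.
  - by apply/measurable_EFinP; apply: measurable_funM => //; exact: measurable_indic.
  rewrite -ip1; apply: eq_integral => t _; rewrite -EFinD -mulrDl.
  rewrite !indicE in_setC; case: (t \in D) => /=; last by rewrite add0r mul1r.
  by rewrite addr0 mul1r.
move: gt0D gt0DC.
case: (\int[mu]_t (\1_D t * p1 t)%:E)%E => [a| |] //;
  case: (\int[mu]_t (\1_(~` D) t * p1 t)%:E)%E => [b| |] //.
rewrite !lte_fin => a0 b0 [ab]; exists a; split => //; lra.
Qed.

(** * Flow out of the tail set at a fixed scale *)

Section fixed_scale.
Variable lam : R.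
Hypothesis lam_gt0 : 0 < lam.
Notation target := (scale_target lam p).

(** Under the scaled target the variable [x_1 / lam] has density [p1], whatever [lam] is. This gives
    the total mass, the mass of [A] and the final one-dimensional integral. *)
Lemma iint_scale_target_head (h : R -> R) :
  measurable_fun setT h -> (forall t, 0 <= h t) ->
  iint (fun x => (h (x 0 ord0 / lam) * target x)%:E) =
  (\int[mu]_t (h t * p1 t)%:E)%E.
Proof.
move=> mh h0.
have mhp : measurable_fun setT (fun t => h t * p1 t) by exact: measurable_funM.
have mhpl : measurable_fun setT (fun t : R => lam^-1 * (h (t / lam) * p1 (t / lam))).
  apply: measurable_funM => //.
  have ml : measurable_fun setT (fun t : R => t / lam) by exact: measurable_funM.
  exact: (measurableT_comp mhp ml).
have mp2 : measurable_fun (T := borelV R n) setT p2.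
  by apply/borel_fun_measurable; case: dp2.
have lamV0 : 0 <= lam^-1 by rewrite invr_ge0 ltW.
have -> : (fun x : 'rV[R]_n.+1 => (h (x 0 ord0 / lam) * target x)%:E) =
    (fun x => (lam^-1 * (h (x 0 ord0 / lam) * p1 (x 0 ord0 / lam)))%:E *
              (p2 (tailv x))%:E)%E.
  apply/funext => x; rewrite (scale_targetE pE) -EFinM; congr EFin; ring.
rewrite (iint_prod (h := fun t => (lam^-1 * (h (t / lam) * p1 (t / lam)))%:E)
  (k := fun y => (p2 y)%:E)).
- have [_ [_ ->]] := dp2; rewrite mule1.
  rewrite -(@integral_scale _ lam (fun t => (h t * p1 t)%:E)) ?gt_eqF//.
  + by apply: eq_integral => t _; rewrite gtr0_norm// EFinM.
  + exact/measurable_EFinP.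
  + by move=> t; rewrite lee_fin mulr_ge0.
- exact/measurable_EFinP.
- exact/measurable_EFinP.
- by move=> t; rewrite lee_fin !mulr_ge0.
- by move=> y; rewrite lee_fin.
Qed.

Let A : set 'rV[R]_n.+1 := [set x | D (x 0 ord0 / lam)].

Let indicA x : \1_A x = \1_D (x 0 ord0 / lam) :> R.
Proof. by rewrite !indicE; congr (_ _)%:R; apply/idP/idP; rewrite !inE. Qed.

Let mA : measurable (A : set (borelV R n.+1)).
Proof.
have m2 : measurable_fun (T := borelV R n.+1) setT (fun x => x 0 ord0 / lam).
  by apply: measurable_funM => //; exact: measurable_coord.
by have := m2 measurableT D mD; rewrite setTI.
Qed.

Let q := mala_density target sigma.
(** [b] is half of the minimal drift [sigma^2 c / (2 lam)], and [U] solves [lam * U = b / 2]. [eps]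
    is the bound of [normal_interval_le] for the radius [lam * M] and the margin [b]. *)
Let U := sigma ^+ 2 * c / (8 * lam ^+ 2).
Let b := sigma ^+ 2 * c / (4 * lam).
Let eps := normal_peak sigma * (2 * (lam * M)) * expR (- b ^+ 2 / (sigma ^+ 2 *+ 2)).

Let eps_ge0 : 0 <= eps.
Proof.
by rewrite !mulr_ge0 ?normal_peak_ge0 ?expR_ge0 ?(ltW lam_gt0)// (le_trans _ M_ge1).
Qed.

Let meanE x : mala_mean sigma target x 0 ord0 =
  x 0 ord0 + sigma ^+ 2 / 2 * (lam^-1 * g (x 0 ord0 / lam)).
Proof.
by rewrite -(grad_scale_target_head p_gt0 p1_ge0 p2_ge0 pE lnp_C1 lam_gt0) !mxE.
Qed.

Let escape x : iint (fun y => (\1_(~` A) y * q x y)%:E) =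
  (\int[mu]_t (\1_[set s : R | `|s| < lam * M] t *
     normal_pdf (mala_mean sigma target x 0 ord0) sigma t)%:E)%E.
Proof.
rewrite -iint_mala_head//; last first.
  have -> : [set s : R | `|s| < lam * M] = ~` [set s | lam * M <= `|s|].
    by apply/seteqP; split => s /=; rewrite ltNge => /negP.
  by apply: measurable_indic; apply: measurableC; exact: measurable_norm_ge.
apply: eq_iint => y; congr (_ * _)%:E; rewrite !indicE; congr (_ _)%:R.
have key : (M <= `|y 0 ord0 / lam|) = (lam * M <= `|y 0 ord0|).
  by rewrite normrM [`|lam^-1|]gtr0_norm ?invr_gt0// ler_pdivlMr// mulrC.
by apply/idP/idP; rewrite !inE /A /D /= ltNge key => /negP.
Qed.

(* For [M <= |u| < U] the drift [sigma^2 g(u) / (2 lam)] is at least [2 b] in size, while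
   the distances [lam |u|] and [lam M] add up to at most [b]. *)
Let escape_le x : (\1_A x * fine (iint (fun y => (\1_(~` A) y * q x y)%:E)) <=
  eps + \1_[set u : R | U <= `|u|] (x 0 ord0 / lam))%R /\
  iint (fun y => (\1_(~` A) y * q x y)%:E) \is a fin_num.
Proof.
set N := iint _.
have N0 : (0 <= N)%E.
  apply: iint_ge0 => y; rewrite lee_fin mulr_ge0// ltW//.
  exact: mala_density_gt0.
have mI (r : R) : measurable_fun setT (\1_[set s : R | `|s| < r] : R -> R).
  have -> : [set s : R | `|s| < r] = ~` [set s | r <= `|s|].
    by apply/seteqP; split => s /=; rewrite ltNge => /negP.
  by apply: measurable_indic; apply: measurableC; exact: measurable_norm_ge.
have N1 : (N <= 1)%E.
  rewrite /N escape -(@integral_normal_pdf _ (mala_mean sigma target x 0 ord0)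
    sigma) ?gt_eqF//.
  apply: ge0_le_integral => //.
  - by move=> t _; rewrite lee_fin mulr_ge0// normal_pdf_ge0.
  - apply/measurable_EFinP; apply: measurable_funM; first exact: mI.
    exact: measurable_normal_pdf.
  - by apply/measurable_EFinP; exact: measurable_normal_pdf.
  - move=> t _; rewrite lee_fin ler_piMl ?normal_pdf_ge0//.
have Nfin : N \is a fin_num by rewrite ge0_fin_numE// (le_lt_trans N1) ?ltry.
split => //; rewrite indicA !indicE.
have [|_] := boolP (_ \in D); last by rewrite mul0r addr_ge0.
rewrite inE mul1r /D /= => Mu.
set u := x 0 ord0 / lam in Mu *.
(* Beyond [U] the escape probability is only bounded by [1], which the indicator supplies. *)
have [uU|] := boolP (u \in _).
  by rewrite /= -[leLHS]add0r lerD// -lee_fin fineK.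
rewrite notin_setE /= => /negP; rewrite -ltNge => uU.
rewrite addr0 -lee_fin fineK// /N escape; apply: normal_interval_le => //.
- by rewrite mulr_ge0 ?(ltW lam_gt0)// (le_trans _ M_ge1).
- by rewrite !mulr_ge0 ?invr_ge0 ?mulr_ge0 ?sqr_ge0// ltW.
rewrite meanE -/u.
have -> : x 0 ord0 = lam * u by rewrite mulrC divfK// gt_eqF.
have lb := lerB_normD (sigma ^+ 2 / 2 * (lam^-1 * g u)) (lam * u).
rewrite [lam * u + _]addrC; apply: le_trans lb.
rewrite normrM [`|sigma ^+ 2 / 2|]ger0_norm ?divr_ge0 ?sqr_ge0//.
rewrite [`|lam^-1 * _|]normrM [`|lam^-1|]gtr0_norm ?invr_gt0//.
rewrite [`|lam * u|]normrM [`|lam|]gtr0_norm//.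
have h1 : lam * `|u| <= lam * U by rewrite ler_wpM2l ?(ltW lam_gt0)// ltW.
have h2 : lam * M <= lam * `|u| by rewrite ler_wpM2l ?(ltW lam_gt0).
have h3 : lam * U = b / 2 by rewrite /U /b; field; rewrite gt_eqF.
have h4 : 2 * b <= sigma ^+ 2 / 2 * (lam^-1 * `|g u|).
  rewrite (_ : 2 * b = sigma ^+ 2 / 2 * (lam^-1 * c)); last first.
    by rewrite /b; field; rewrite gt_eqF.
  by rewrite !ler_wpM2l ?invr_ge0 ?(ltW lam_gt0) ?divr_ge0 ?sqr_ge0// g_ge.
lra.
Qed.

Hypothesis MU : M <= U.

Let K2 := (p1 M + p1 (- M)) * expR (c * M) * (4 / c).

(** The bound of [escape_le] depends on [x] through [x_1 / lam] alone, so it is integrated against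
    [p1]: [eps] meets total mass [1], and the indicator meets the tail mass beyond [U]. *)
Lemma flow_le : (iint (fun x => iint (fun y =>
    (\1_A x * target x * (\1_(~` A) y * q x y))%:E)) <=
  (eps + K2 * expR (- (c / 2) * U))%:E)%E.
Proof.
have mt := @measurable_scale_target R n p lam bp.
have t0 x : 0 < target x by exact: scale_target_gt0.
have q0 x y : 0 < q x y by exact: mala_density_gt0.
have mq : measurable_fun setT
    (fun z : borelV R n.+1 * borelV R n.+1 => q z.1 z.2).
  apply: measurable_mala_density => i.
  exact: (measurable_grad_scale_target p_gt0 p1_ge0 p2_ge0 pE lnp_C1 lam_gt0).
pose h (t : R) : R := eps + \1_[set u : R | U <= `|u|] t.
have mIU : measurable_fun setT (\1_[set u : R | U <= `|u|] : R -> R).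
  by apply: measurable_indic; exact: measurable_norm_ge.
have mh : measurable_fun setT h by exact: measurable_funD.
have h0 t : 0 <= h t by rewrite addr_ge0.
have mAC1 : measurable_fun setT (fun y : borelV R n.+1 => \1_(~` A) y : R).
  by apply: measurable_indic; exact: measurableC.
apply: (@le_trans _ _ (iint (fun x => (h (x 0 ord0 / lam) * target x)%:E))).
  apply: le_iint.
  - have mf := measurable_flow mt mq mA.
    have mfE : measurable_fun setT (fun z : borelV R n.+1 * borelV R n.+1 =>
      (\1_A z.1 * target z.1 * (\1_(~` A) z.2 * q z.1 z.2))%:E).
      exact/measurable_EFinP.
    apply: (measurable_iint mfE) => z.
    by rewrite lee_fin; apply: mulr_ge0; apply: mulr_ge0 => //; exact: ltW.
  - apply/measurable_EFinP; apply: measurable_funM => //.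
    have m2 : measurable_fun (T := borelV R n.+1) setT (fun x => x 0 ord0 / lam).
      by apply: measurable_funM => //; exact: measurable_coord.
    exact: (measurableT_comp mh m2).
  - by move=> x; apply: iint_ge0 => y; rewrite lee_fin;
      apply: mulr_ge0; apply: mulr_ge0 => //; exact: ltW.
  - move=> x; have [le fin] := escape_le x.
    under eq_iint do rewrite EFinM.
    rewrite iintZl.
    + rewrite -(fineK fin) -EFinM lee_fin mulrAC ler_wpM2r// ltW//.
    + apply/measurable_EFinP.
      apply: (measurable_funM mAC1).
      exact: (measurable_fun_pair2 (x : borelV R n.+1) mq).
    + by move=> y; rewrite lee_fin mulr_ge0// ltW.
    + by rewrite lee_fin mulr_ge0// ltW.
rewrite iint_scale_target_head//.
under eq_integral do rewrite mulrDl EFinD.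
rewrite ge0_integralD//; last 4 first.
- by move=> t _; rewrite lee_fin mulr_ge0.
- by apply/measurable_EFinP; exact: measurable_funM.
- by move=> t _; rewrite lee_fin mulr_ge0.
- by apply/measurable_EFinP; exact: measurable_funM.
rewrite EFinD leeD//.
  under eq_integral do rewrite EFinM.
  rewrite ge0_integralZl ?ip1 ?mule1//.
  - exact/measurable_EFinP.
  - by move=> t _; rewrite lee_fin.
exact: (integral_tail_le p1_gt0 mp1 ip1
  (is_derive_lnp1 p_gt0 p1_ge0 p2_ge0 pE lnp_C1)
  (continuous_derive_lnp1 p_gt0 p1_ge0 p2_ge0 pE lnp_C1) c_gt0 g_ge MU).
Qed.

Lemma Gap_scale_target_le (a : R) : 0 < a -> a < 1 ->
  (\int[mu]_t (\1_D t * p1 t)%:E = a%:E)%E ->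
  (Gap target q <=
    ((a * (1 - a))^-1 * (eps + K2 * expR (- (c / 2) * U)))%:E)%E.
Proof.
move=> a0 a1 ia; rewrite EFinM.
apply: le_trans (lee_wpmul2l _ flow_le); last first.
  by rewrite lee_fin invr_ge0 mulr_ge0 ?subr_ge0 ?ltW.
apply: Gap_le_flow => //.
- exact: measurable_scale_target.
- by move=> x; exact: scale_target_gt0.
- apply: measurable_mala_density => i.
  exact: (measurable_grad_scale_target p_gt0 p1_ge0 p2_ge0 pE lnp_C1 lam_gt0).
- by move=> x y; exact: mala_density_gt0.
- have := @iint_scale_target_head (cst 1).
  under eq_iint do rewrite mul1r.
  under eq_integral do rewrite mul1r.
  by rewrite ip1; apply.
- under eq_iint do rewrite indicA.
  by rewrite iint_scale_target_head//; exact: measurable_indic.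
Qed.

End fixed_scale.

(** With [k = sigma^2 c^2 / 32], the Gaussian exponent [b^2 / (2 sigma^2)] equals [k / lam^2] and
    the tail exponent [(c / 2) * U] equals [2 k / lam^2], so the Gaussian term sets the rate. The
    factor [lam] in [eps] is bounded by [1]. *)
Lemma Gap_mala_le : exists K : R, 0 <= K /\ forall lam : R, 0 < lam -> lam <= 1 ->
  M <= sigma ^+ 2 * c / (8 * lam ^+ 2) ->
  (Gap (scale_target lam p) (mala_density (scale_target lam p) sigma) <=
   (K * expR (- (sigma ^+ 2 * c ^+ 2 / 32) / lam ^+ 2))%:E)%E.
Proof.
have [a [a0 a1 ia]] := mass_outside.
pose K1 := normal_peak sigma * (2 * M).
pose K2 := (p1 M + p1 (- M)) * expR (c * M) * (4 / c).
have M0 : 0 <= M by exact: le_trans M_ge1.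
have K10 : 0 <= K1 by rewrite !mulr_ge0 ?normal_peak_ge0.
have K20 : 0 <= K2 by rewrite !mulr_ge0 ?addr_ge0 ?expR_ge0 ?invr_ge0 ?(ltW c_gt0).
have V0 : 0 <= (a * (1 - a))^-1 by rewrite invr_ge0 mulr_ge0 ?subr_ge0 ?ltW.
exists ((a * (1 - a))^-1 * (K1 + K2)); split; first by rewrite mulr_ge0// addr_ge0.
move=> lam lam0 lam1 MU.
apply: (le_trans (Gap_scale_target_le lam0 MU a0 a1 ia)).
rewrite lee_fin -[leRHS]mulrA ler_wpM2l// [leRHS]mulrDl lerD//.
  rewrite /K1 (_ : - (_ / _) ^+ 2 / _ =
     - (sigma ^+ 2 * c ^+ 2 / 32) / lam ^+ 2); last first.
    by rewrite -mulr_natr; field; rewrite !gt_eqF.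
  rewrite ler_wpM2r ?expR_ge0// ler_wpM2l ?normal_peak_ge0// ler_wpM2l//.
  by rewrite ler_piMl.
rewrite -/K2 ler_wpM2l// ler_expR.
rewrite (_ : - (c / 2) * _ = - (sigma ^+ 2 * c ^+ 2 / 32) / lam ^+ 2 -
   (sigma ^+ 2 * c ^+ 2 / 32) / lam ^+ 2); last by field; rewrite gt_eqF.
rewrite gerBl; apply: divr_ge0; last exact: sqr_ge0.
by apply: divr_ge0 => //; apply: mulr_ge0; exact: sqr_ge0.
Qed.

End gap_bound.

(** For [lam <= 1] both [lam^-(1+q)] and [lam^-q] are at most [lam^-2]. With [y = (k / 2) / lam^2]
    the left side is then at most [- y - 2 ln lam], and [1 + ln y <= y] finishes. *)
Lemma exponent_le (R : realType) (k q lam : R) :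
  0 < k -> 0 <= q -> q < 1 -> 0 < lam -> lam <= 1 ->
  - k / lam ^+ 2 + (k / 2 * lam `^ (- (1 + q)) - q * ln lam) <= - ln (k / 2).
Proof.
move=> k0 q0 q1 lam0 lam1; have k20 : 0 < k / 2 by rewrite divr_gt0.
have lnlam : ln lam <= 0 by rewrite ln_le0.
have lam2 : expR (- 2 * ln lam) = (lam ^+ 2)^-1.
  by rewrite mulNr expRN -{2}[lam]lnK ?posrE// -expRM_natl mulr_natl.
have h1 : k / 2 * lam `^ (- (1 + q)) <= k / 2 * (lam ^+ 2)^-1.
  rewrite ler_wpM2l ?(ltW k20)// -lam2 /powR gt_eqF// ler_expR.
  by rewrite ler_wnM2r//; lra.
have h2 : - q * ln lam <= - 2 * ln lam by rewrite ler_wnM2r//; lra.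
have h3 := expR_ge1Dx (ln (k / 2) - 2 * ln lam).
rewrite expRD -mulNr lam2 lnK ?posrE// in h3.
rewrite -mulNr; move: h1 h2 h3; lra.
Qed.

(* d = n.+1 *)
Theorem theorem2p2 (R : realType) (n : nat) (p : 'rV[R]_n.+1 -> R) (q sigma : R) :
  densityn p ->
  (forall x, 0 < p x) ->
  C1 (fun x => ln (p x)) ->
  0 <= q -> q < 1 ->
  (exists (p1 : R -> R) (p2 : 'rV[R]_n -> R),
      density1 p1 /\ densityn p2 /\
      (forall x, p x = p1 (x 0 ord0) * p2 (tailv x)) /\
      (exists c C M : R, 0 < c /\ 0 < C /\
         forall t : R, M <= `|t| ->
           c * `|t| `^ q <= `|derive1 (fun s => ln (p1 s)) t| /\
           `|derive1 (fun s => ln (p1 s)) t| <= C * `|t| `^ q)) ->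
  0 < sigma ->
  exists gamma : R, 0 < gamma /\
    exists K : R,
      \forall lam \near 0^'+,
        (Gap (scale_target lam p) (mala_density (scale_target lam p) sigma)
           * (expR (gamma * lam `^ (- (1 + q)) - q * ln lam))%:E <= K%:E)%E.
Proof.
move=> [bp _] p0 pC1 q0 q1 [p1 [p2 [dp1 [dp2 [pE [c [C [M0 [c0 [_ hg]]]]]]]]]] s0.
(* For [|t| >= 1] the power [|t|^q] is at least [1], so the growth condition yields the uniform
   lower bound [c]. *)
pose M := Num.max M0 1.
have M1 : 1 <= M by rewrite le_max lexx orbT.
have g_ge t : M <= `|t| -> c <= `|derive1 (fun s => ln (p1 s)) t|.
  rewrite ge_max => /andP[/hg[+ _] t1]; apply: le_trans.
  by rewrite ler_peMr ?(ltW c0)// -[leLHS](powRr0 `|t|) ler_powR.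
have [K [K0 hK]] := Gap_mala_le bp p0 dp1 dp2 pE pC1 s0 c0 M1 g_ge.
set k := sigma ^+ 2 * c ^+ 2 / 32 in hK.
have k0 : 0 < k by rewrite !mulr_gt0 ?invr_gt0 ?exprn_gt0.
(* Half of the rate [k] is kept back to absorb the factor [lam^-q]. *)
exists (k / 2); split; first by rewrite divr_gt0.
exists (K * expR (- ln (k / 2))).
near=> lam.
have lam0 : 0 < lam by near: lam; exact: nbhs_right_gt.
have lam1 : lam <= 1 by near: lam; exact: nbhs_right_le.
(* A bound linear in [lam] suffices: together with [lam <= 1] it gives [8 M lam^2 <= sigma^2 c],
   which is the requirement [M <= U]. *)
have lamM : lam <= sigma ^+ 2 * c / (8 * M).
  near: lam; apply: nbhs_right_le.
  by rewrite !mulr_gt0 ?invr_gt0 ?exprn_gt0 ?mulr_gt0 ?(lt_le_trans ltr01 M1).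
have MU : M <= sigma ^+ 2 * c / (8 * lam ^+ 2).
  have M0' : 0 < M by exact: (lt_le_trans ltr01 M1).
  rewrite ler_pdivlMr ?mulr_gt0 ?exprn_gt0//.
  move: lamM; rewrite ler_pdivlMr ?mulr_gt0// => lamM.
  apply: le_trans lamM.
  rewrite (_ : M * (8 * lam ^+ 2) = lam * (lam * (8 * M))); last by ring.
  by rewrite ler_piMl// !mulr_ge0 ?ltW.
apply: (le_trans (lee_wpmul2r _ (hK _ lam0 lam1 MU))).
  by rewrite lee_fin expR_ge0.
by rewrite -EFinM lee_fin -[leLHS]mulrA ler_wpM2l// -expRD ler_expR exponent_le.
Unshelve. all: by end_near. Qed.
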